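(* Let $T$ be a linear operator in $H$ with domain $\operatorname{dom}(T)$ (not necessarily closed, closable or densely defined). Let $\mathcal V$ be the set of all finite-dimensional subspaces $V\subset H$, and define \[ W_{e1}(T):=\bigcap_{V\in\mathcal V}\overline{W(T|_{V^{\perp}\cap\operatorname{dom}(T)})},\qquad W_{e2}(T):=\bigcap_{K\in L(H),\ \operatorname{rank}K<\infty}\overline{W(T+K)}, \] \[ W_{e3}(T):=\bigcap_{K\in L(H),\ K\text{ compact}}\overline{W(T+K)}, \] \[ W_{e4}(T):=\{\lambda\in\mathbb C:\ \exists\,(e_n)_{n\in\mathbb N}\subset\operatorname{dom}(T)\text{ orthonormal with }\langle Te_n,e_n\rangle\to\lambda\}. \] Then in general \[ W_{e1}(T)\subset W_{e4}(T)\subset W_{e2}(T)=W_{e3}(T)=W_e(T). \] If $\overline{\operatorname{dom}(T)}=H$, then \[ W_{e1}(T)\subset W_{e4}(T)=W_{e2}(T)=W_{e3}(T)=W_e(T). \] If $\overline{\operatorname{dom}(T)\cap\operatorname{dom}(T^* )}=H$ or if $W(T)\neq\mathbb C$, then $W_{ei}(T)=W_e(T)$ for $i=1,2,3,4$.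
   Context: $H$ is a separable infinite-dimensional complex Hilbert space with inner product $\langle\cdot,\cdot\rangle$ and norm $\|\cdot\|$; $x_n\stackrel{w}{\to}x$ denotes weak convergence; $L(H)$ is the space of bounded linear operators on $H$. For a linear operator $T$ with domain $\operatorname{dom}(T)\subset H$, the numerical range is $W(T)=\{\langle Tx,x\rangle: x\in\operatorname{dom}(T),\ \|x\|=1\}$, and the essential numerical range is $W_e(T)=\{\lambda\in\mathbb C:\exists\,(x_n)_{n\in\mathbb N}\subset\operatorname{dom}(T)\text{ with }\|x_n\|=1,\ x_n\stackrel{w}{\to}0,\ \langle Tx_n,x_n\rangle\to\lambda\}$. For a subspace $M\subset\operatorname{dom}(T)$, $T|_M$ denotes the restriction of $T$ to $M$ (so $W(T|_M)=\{\langle Tx,x\rangle:x\in M,\|x\|=1\}$). $T^*$ is the Hilbert space adjoint (defined when $T$ is densely defined); $T+K$ has domain $\operatorname{dom}(T)$. *)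

(* Defs.v *)
(* realType R from mathcomp-analysis (reals), complex numbers R[i]
   from mathcomp-real-closed. A complex Hilbert space is given as an lmodType over
   R[i] together with an inner product satisfying the Hilbert-space axioms. *)
From mathcomp Require Import all_boot all_algebra.
From mathcomp Require Import reals.
From mathcomp Require Export complex.
Set Implicit Arguments. Unset Strict Implicit. Unset Printing Implicit Defensive.
Import GRing.Theory Num.Theory.
Local Open Scope ring_scope.
Local Open Scope complex_scope.

Section Hilbert.
Variable R : realType.
Local Notation C := R[i].

(* modulus of a complex number *)
Definition cabs (z : C) : R := Num.sqrt (complex.Re z ^+ 2 + complex.Im z ^+ 2).

(* convergence of complex sequences *)
Definition ccvg (u : nat -> C) (l : C) : Prop :=
  forall eps : R, 0 < eps -> exists N : nat, forall n, (N <= n)%N -> cabs (u n - l) < eps.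

(* closure of a subset of C *)
Definition cclosure (S : C -> Prop) : C -> Prop :=
  fun l => forall eps : R, 0 < eps -> exists z, S z /\ cabs (z - l) < eps.

Definition set_eqC (A B : C -> Prop) : Prop := forall z, A z <-> B z.
Definition set_subC (A B : C -> Prop) : Prop := forall z, A z -> B z.

Variable V : lmodType C.
Variable ip : V -> V -> C.   (* inner product, linear in the first argument *)

Definition vnorm (x : V) : R := Num.sqrt (complex.Re (ip x x)).

(* finite linear span of a finite family *)
Definition in_span (s : seq V) (x : V) : Prop :=
  exists c : 'I_(size s) -> C, x = \sum_(i < size s) c i *: s`_i.

Definition is_subspace (M : V -> Prop) : Prop :=
  M 0 /\ forall (a : C) x y, M x -> M y -> M (a *: x + y).

Definition finite_dim_subspace (M : V -> Prop) : Prop :=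
  is_subspace M /\ exists s : seq V, forall x, M x <-> in_span s x.

Definition orth_compl (M : V -> Prop) : V -> Prop :=
  fun x => forall v, M v -> ip x v = 0.

Definition dense (S : V -> Prop) : Prop :=
  forall x (eps : R), 0 < eps -> exists y, S y /\ vnorm (x - y) < eps.

Definition is_complex_hilbert : Prop :=
  (* sesquilinear, Hermitian, positive definite *)
  (forall (a : C) x y z, ip (a *: x + y) z = a * ip x z + ip y z) /\
  (forall x y, ip x y = (ip y x)^*) /\
  (forall x, 0 <= complex.Re (ip x x)) /\
  (forall x, ip x x = 0 -> x = 0) /\
  (* complete *)
  (forall u : nat -> V,
     (forall eps : R, 0 < eps -> exists N : nat, forall m n,
        (N <= m)%N -> (N <= n)%N -> vnorm (u m - u n) < eps) ->
     exists l, forall eps : R, 0 < eps -> exists N : nat, forall n,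
        (N <= n)%N -> vnorm (u n - l) < eps) /\
  (* separable *)
  (exists d : nat -> V, dense (fun y => exists n, y = d n)) /\
  (* infinite-dimensional *)
  ~ (exists s : seq V, forall x, in_span s x).

(* a linear operator T with domain D: T is only relevant on D *)
Definition lin_op_on (D : V -> Prop) (T : V -> V) : Prop :=
  is_subspace D /\
  forall (a : C) x y, D x -> D y -> T (a *: x + y) = a *: T x + T y.

(* numerical range of T restricted to M *)
Definition num_range (T : V -> V) (M : V -> Prop) : C -> Prop :=
  fun z => exists x, M x /\ vnorm x = 1 /\ z = ip (T x) x.

Definition weak_to0 (x : nat -> V) : Prop :=
  forall y, ccvg (fun n => ip (x n) y) 0.

(* essential numerical range *)
Definition ess_num_range (D : V -> Prop) (T : V -> V) : C -> Prop :=
  fun l => exists x : nat -> V, (forall n, D (x n)) /\ (forall n, vnorm (x n) = 1) /\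
     weak_to0 x /\ ccvg (fun n => ip (T (x n)) (x n)) l.

(* bounded linear operators on H *)
Definition bounded_op (K : V -> V) : Prop :=
  (forall (a : C) x y, K (a *: x + y) = a *: K x + K y) /\
  exists M : R, forall x, vnorm (K x) <= M * vnorm x.

Definition finite_rank (K : V -> V) : Prop :=
  exists s : seq V, forall x, in_span s (K x).

Definition compact_op (K : V -> V) : Prop :=
  forall u : nat -> V, (exists M : R, forall n, vnorm (u n) <= M) ->
  exists phi : nat -> nat, (forall n, (phi n < phi n.+1)%N) /\
  exists l, forall eps : R, 0 < eps -> exists N : nat, forall n,
     (N <= n)%N -> vnorm (K (u (phi n)) - l) < eps.

Definition We1 (D : V -> Prop) (T : V -> V) : C -> Prop :=
  fun l => forall M : V -> Prop, finite_dim_subspace M ->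
     cclosure (num_range T (fun x => orth_compl M x /\ D x)) l.

Definition We2 (D : V -> Prop) (T : V -> V) : C -> Prop :=
  fun l => forall K : V -> V, bounded_op K -> finite_rank K ->
     cclosure (num_range (fun x => T x + K x) D) l.

Definition We3 (D : V -> Prop) (T : V -> V) : C -> Prop :=
  fun l => forall K : V -> V, bounded_op K -> compact_op K ->
     cclosure (num_range (fun x => T x + K x) D) l.

Definition orthonormal_seq (e : nat -> V) : Prop :=
  forall m n, ip (e m) (e n) = (if m == n then 1 else 0).

Definition We4 (D : V -> Prop) (T : V -> V) : C -> Prop :=
  fun l => exists e : nat -> V, (forall n, D (e n)) /\ orthonormal_seq e /\
     ccvg (fun n => ip (T (e n)) (e n)) l.

(* domain of the Hilbert-space adjoint T^* *)
Definition adj_dom (D : V -> Prop) (T : V -> V) : V -> Prop :=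
  fun y => exists z, forall x, D x -> ip (T x) y = ip x z.

End Hilbert.

(* Main.v *)
(* Write q(x) = <Tx, x>.

   Convexity: for unit vectors x1, x2 and a second form p, every convex combination of
   q(x1), q(x2) is the value q(y) at a unit vector y in their span with p(y) at most the
   same combination of p(x1), p(x2).

   We2 in We: if l is not in We, then, for a finite sum p of squares |<., d_i>|^2 over a
   dense sequence d, the convex set of all (q(x) - l, s) with s >= p(x) stays away from 0.
   Separating it from 0 gives a functional Re (a (q - l)) + b p >= eta > 0 with b >= 0. If
   a <> 0, the finite-rank perturbation K = (b/a) sum <., d_i> d_i pushes W(T + K) away
   from l; if a = 0, then dom T is finite-dimensional and a large multiple does it.

   We in We1 under the last hypothesis: a weakly null sequence x_n is corrected into V^perp
   by subtracting sum <x_n, h> g with finitely many g in dom T; the value of q changes by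
   o(1) as soon as <T x_n, g> is bounded. This is clear for g in dom T^*, and when W(T) lies
   in a half-plane it is the Cauchy-Schwarz inequality of the real part of the form.

   We in We4: suppose l is not in We1, so that q - l lies in a
   half-plane on E = V^perp in dom T for some V. If <Tu, g> were bounded by 1 + |q(u)| + |u|^2
   on E for each of the finitely many correcting vectors g, the correction into E would
   succeed and contradict the choice of V. Otherwise there are u_n in E with u_n -> 0,
   q(u_n) -> 0 and |<T u_n, g>| -> oo, and every value is attained approximately at
   y + u_n + zeta_n g for any unit y in E and suitable zeta_n -> 0, which leaves enough room
   to build an orthonormal sequence. *)
Require Import Defs.
From mathcomp Require Import all_boot all_order all_algebra.
From mathcomp Require Import boolp classical_sets reals.
From mathcomp Require Import complex ring lra.
Set Implicit Arguments. Unset Strict Implicit. Unset Printing Implicit Defensive.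
Import Order.TTheory GRing.Theory Num.Theory ComplexField.Normc.
Local Open Scope ring_scope.
Local Open Scope complex_scope.

(** * Null real sequences and extraction of subsequences *)

Section NullSequences.
Variable R : realType.
Implicit Types a b u : nat -> R.

(** The bound is one-sided, so this means convergence to 0 only for nonnegative sequences; it is
    applied to moduli, norms and the like. *)
Definition null a := forall eps : R, 0 < eps ->
  exists N : nat, forall n, (N <= n)%N -> a n < eps.

Lemma null_le a b : (forall n, b n <= a n) -> null a -> null b.
Proof.
move=> ba a0 e e0; have [N aN] := a0 e e0.
by exists N => n /aN; apply: le_lt_trans.
Qed.

Lemma nullD a b : null a -> null b -> null (fun n => a n + b n).
Proof.
move=> a0 b0 e e0; have e2 : 0 < e / 2 by lra.
have [N aN] := a0 _ e2; have [M bM] := b0 _ e2.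
exists (maxn N M) => n; rewrite geq_max => /andP[/aN ? /bM ?]; lra.
Qed.

Lemma nullM (c : R) a : 0 <= c -> null a -> null (fun n => c * a n).
Proof.
move=> c0 a0 e e0.
have ec : 0 < e / (c + 1) by apply: divr_gt0; lra.
have [N aN] := a0 _ ec; exists N => n /aN.
rewrite ltr_pdivlMr; last by lra.
by move=> an; nra.
Qed.

Lemma null0 : null (fun=> 0).
Proof. by move=> e e0; exists 0%N. Qed.

Lemma strict_mono_ge (phi : nat -> nat) :
  (forall n, (phi n < phi n.+1)%N) -> forall n, (n <= phi n)%N.
Proof. by move=> phiS; elim=> // n /leq_ltn_trans; apply. Qed.

Lemma null_subseq a (phi : nat -> nat) :
  (forall n, (n <= phi n)%N) -> null a -> null (fun n => a (phi n)).
Proof.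
move=> phin a0 e /a0[N aN]; exists N => n Nn.
by apply: aN; apply: leq_trans (phin n).
Qed.

Lemma archi_nat (x : R) : exists n : nat, x < n%:R.
Proof. by exists (Num.truncn x).+1; apply: truncnS_gt. Qed.

Lemma null_inv : null (fun n => n.+1%:R^-1).
Proof.
move=> e e0; have [N eN] := archi_nat e^-1; exists N => n Nn.
rewrite invf_plt ?posrE // (lt_le_trans eN) // ler_nat; exact: leq_trans Nn _.
Qed.

Lemma subseq_choice (P : nat -> nat -> Prop) :
  (forall k N, exists n, (N <= n)%N /\ P k n) ->
  exists phi : nat -> nat, (forall n, (phi n < phi n.+1)%N) /\ forall k, P k (phi k).
Proof.
move=> H; have [f fP] := choice (fun kN : nat * nat => H kN.1 kN.2).
pose phi := fix phi k := match k with 0%N => f (0, 0)%N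
  | k'.+1 => f (k'.+1, (phi k').+1) end.
exists phi; split=> [n|[|k]] /=; first by have [] := fP (n.+1, (phi n).+1).
  by have [] := fP (0, 0)%N.
by have [] := fP (k.+1, (phi k).+1).
Qed.

(* The limit is the supremum of the [x] such that [x <= u n] for infinitely many [n]. *)
Lemma bolzano_weierstrass u (M : R) : (forall n, `|u n| <= M) ->
  exists phi : nat -> nat, (forall n, (phi n < phi n.+1)%N) /\
  exists l, null (fun n => `|u (phi n) - l|).
Proof.
move=> uM.
pose S : set R := fun x => forall N, exists n, (N <= n)%N /\ x <= u n.
have S0 : S (- M) by move=> N; exists N; split=> //; have := uM N; rewrite ler_norml => /andP[].
have Sub : ubound S M.
  move=> x /(_ 0%N)[n [_ xu]]; apply: le_trans xu _.
  by have := uM n; rewrite ler_norml => /andP[].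
have supS : has_sup S by split; [exists (- M) | exists M].
pose l := sup S.
have near (e : R) : 0 < e -> forall N, exists n, (N <= n)%N /\ `|u n - l| < e.
  move=> e0; have [x Sx xl] := sup_adherent e0 supS.
  have /existsNP[N0 HN0] : ~ S (l + e).
    by move=> /(ub_le_sup supS.2); rewrite -/l; lra.
  move=> N; have [n [Nn xu]] := Sx (maxn N N0).
  move: Nn; rewrite geq_max => /andP[Nn N0n]; exists n; split=> //.
  have ult : u n < l + e by rewrite ltNge; apply/negP => h; apply: HN0; exists n.
  by rewrite ltr_norml; move: xl; rewrite -/l => xl; lra.
have [phi [phiS phiP]] := subseq_choice
  (fun k => near k.+1%:R^-1 (ltac:(by rewrite invr_gt0))).
exists phi; split=> //; exists l.
by apply: null_le null_inv => n; apply: ltW.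
Qed.

(** Induction on the number of sequences: each new one costs a further extraction, which preserves
    the limits already found. *)
Lemma bolzano_weierstrass_family (u : nat -> nat -> R) (M : R) (k : nat) :
  (forall i n, (i < k)%N -> `|u i n| <= M) ->
  exists phi : nat -> nat, (forall n, (phi n < phi n.+1)%N) /\
  exists l : nat -> R, forall i, (i < k)%N -> null (fun n => `|u i (phi n) - l i|).
Proof.
elim: k => [|k IHk] uM; first by exists id; split=> //; exists (fun=> 0).
have [|phi [phiS [l ul]]] := IHk; first by move=> i n ik; apply: uM; apply: ltnW.
have [|psi [psiS [lk ulk]]] := @bolzano_weierstrass (fun n => u k (phi n)) M.
  by move=> n; apply: uM.
exists (phi \o psi); split=> [n|] /=.
  have phim : {homo phi : m n / (m < n)%N} by apply: homo_ltn => // y x z; apply: ltn_trans.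
  exact: phim.
exists (fun i => if i == k then lk else l i) => i; rewrite ltnS leq_eqVlt.
case: eqVneq => [-> _|_ /= ik]; first exact: ulk.
exact: (null_subseq (strict_mono_ge psiS) (ul i ik)).
Qed.

Lemma eventually_bounded a (N : nat) (M : R) :
  (forall n, (N <= n)%N -> a n <= M) -> exists M', forall n, a n <= M'.
Proof.
move=> aM; exists (`|M| + \sum_(i < N) `|a i|) => n; have [/aM an|nN] := leqP N n.
  by apply: le_trans an (le_trans (ler_norm M) _); rewrite lerDl sumr_ge0.
rewrite (bigD1 (Ordinal nN)) //= addrCA; apply: le_trans (ler_norm _) _.
by rewrite lerDl addr_ge0 // sumr_ge0.
Qed.

End NullSequences.

(** * Modulus, real part and null sequences of complex numbers *)

Section Modulus.
Variable R : realType.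
Implicit Types z w : R[i].

Lemma cabsE z : cabs z = normc z. Proof. by case: z. Qed.

Lemma cabs_ge0 z : 0 <= cabs z. Proof. exact: sqrtr_ge0. Qed.

Lemma cabsD z w : cabs (z + w) <= cabs z + cabs w.
Proof. by rewrite !cabsE le_normcD. Qed.

Lemma cabsN z : cabs (- z) = cabs z. Proof. by rewrite !cabsE normcN. Qed.

Lemma cabsB z w : cabs (z - w) <= cabs z + cabs w.
Proof. by rewrite -(cabsN w) cabsD. Qed.

Lemma cabsM z w : cabs (z * w) = cabs z * cabs w.
Proof. by rewrite !cabsE normcM. Qed.

Lemma cabsV z : cabs z^-1 = (cabs z)^-1.
Proof. by rewrite !cabsE normcV. Qed.

Lemma cabs0 : cabs (0 : R[i]) = 0. Proof. by rewrite cabsE normc0. Qed.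

Lemma cabs1 : cabs (1 : R[i]) = 1. Proof. by rewrite cabsE normc1. Qed.

Lemma cabs_eq0 z : (cabs z == 0) = (z == 0).
Proof.
apply/eqP/eqP => [|->]; last exact: cabs0.
by rewrite cabsE => /eq0_normc.
Qed.

Lemma cabs_gt0 z : (0 < cabs z) = (z != 0).
Proof. by rewrite lt_def cabs_eq0 cabs_ge0 andbT. Qed.

Lemma cabs_real (x : R) : cabs x%:C = `|x|.
Proof. by rewrite /cabs /= expr0n addr0 sqrtr_sqr. Qed.

Lemma cabsJ z : cabs (conjc z) = cabs z.
Proof. by case: z => x y; rewrite /cabs /= sqrrN. Qed.

Lemma cabs_sqr z : cabs z ^+ 2 = complex.Re z ^+ 2 + complex.Im z ^+ 2.
Proof. by rewrite sqr_sqrtr // addr_ge0 ?sqr_ge0. Qed.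

Lemma mulcJ z : z * conjc z = (cabs z ^+ 2)%:C.
Proof.
by rewrite cabs_sqr; case: z => x y /=; congr Complex; ring.
Qed.

Lemma Re_le_cabs z : `|complex.Re z| <= cabs z.
Proof. by rewrite -sqrtr_sqr ler_wsqrtr // lerDl sqr_ge0. Qed.

Lemma Im_le_cabs z : `|complex.Im z| <= cabs z.
Proof. by rewrite -sqrtr_sqr ler_wsqrtr // lerDr sqr_ge0. Qed.

Lemma cabs_le z : cabs z <= `|complex.Re z| + `|complex.Im z|.
Proof.
rewrite -(ler_pXn2r (n := 2)) ?nnegrE ?cabs_ge0 ?addr_ge0 // cabs_sqr.
rewrite sqrrD !real_normK ?num_real //.
by have := mulr_ge0 (normr_ge0 (complex.Re z)) (normr_ge0 (complex.Im z)); lra.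
Qed.

Lemma ReD z w : complex.Re (z + w) = complex.Re z + complex.Re w.
Proof. by case: z w => ? ? []. Qed.

Lemma ReN z : complex.Re (- z) = - complex.Re z.
Proof. by case: z. Qed.

Lemma ReB z w : complex.Re (z - w) = complex.Re z - complex.Re w.
Proof. by rewrite ReD ReN. Qed.

Lemma ReJ z : complex.Re (conjc z) = complex.Re z.
Proof. by case: z. Qed.

Lemma Re_realM (x : R) z : complex.Re (x%:C * z) = x * complex.Re z.
Proof. by case: z => a b /=; rewrite mul0r subr0. Qed.

Lemma conjcD z w : conjc (z + w) = conjc z + conjc w.
Proof. exact: rmorphD. Qed.

Lemma conjcN z : conjc (- z) = - conjc z.
Proof. exact: rmorphN. Qed.

Lemma conjcM z w : conjc (z * w) = conjc z * conjc w.
Proof. exact: rmorphM. Qed.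

Definition cnull (u : nat -> R[i]) := null (fun n => cabs (u n)).

Implicit Types u v : nat -> R[i].

Lemma cnull_le (a : nat -> R) u : (forall n, cabs (u n) <= a n) -> null a -> cnull u.
Proof. exact: null_le. Qed.

Lemma cnull_eq u v : u =1 v -> cnull u -> cnull v.
Proof. by move=> uv; apply: null_le => n; rewrite uv. Qed.

Lemma cnullD u v : cnull u -> cnull v -> cnull (fun n => u n + v n).
Proof. by move=> u0 v0; apply: cnull_le (nullD u0 v0) => n; apply: cabsD. Qed.

Lemma cnullN u : cnull u -> cnull (fun n => - u n).
Proof. by apply: null_le => n; rewrite cabsN. Qed.

Lemma cnullB u v : cnull u -> cnull v -> cnull (fun n => u n - v n).
Proof. by move=> u0 v0; apply: cnullD u0 (cnullN v0). Qed.

Lemma cnullJ u : cnull u -> cnull (fun n => conjc (u n)).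
Proof. by apply: null_le => n; rewrite cabsJ. Qed.

Lemma cnullM u v (M : R) : cnull u -> (forall n, cabs (v n) <= M) ->
  cnull (fun n => u n * v n).
Proof.
move=> u0 vM; have M0 : 0 <= M by apply: le_trans (vM 0%N); apply: cabs_ge0.
apply: cnull_le (nullM M0 u0) => n; rewrite cabsM mulrC.
by apply: ler_wpM2r; rewrite ?cabs_ge0.
Qed.

Lemma cnull_sum (I : eqType) (s : seq I) (F : I -> nat -> R[i]) :
  (forall i, i \in s -> cnull (F i)) -> cnull (fun n => \sum_(i <- s) F i n).
Proof.
elim: s => [|i s IHs] F0.
  by apply: cnull_le (@null0 R) => n; rewrite big_nil cabs0.
apply: (@cnull_eq (fun n => F i n + \sum_(i <- s) F i n)).
  by move=> n; rewrite big_cons.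
apply: cnullD; first by apply: F0; rewrite mem_head.
by apply: IHs => j js; apply: F0; rewrite in_cons js orbT.
Qed.

Lemma ccvg_perturb u v l : ccvg u l -> cnull (fun n => v n - u n) -> ccvg v l.
Proof.
move=> ul uv; apply: (cnull_eq _ (cnullD uv ul)) => n.
by rewrite addrA subrK.
Qed.

Lemma cnull_bounded u : cnull u -> exists M : R, forall n, cabs (u n) <= M.
Proof.
move=> /(_ 1 ltr01)[N uN]; apply: (eventually_bounded (N := N) (M := 1)) => n /uN.
exact: ltW.
Qed.

Lemma ccvg_bounded u l : ccvg u l -> exists M : R, forall n, cabs (u n) <= M.
Proof.
move=> /cnull_bounded[M uM]; exists (M + cabs l) => n.
by rewrite -[u n](subrK l); apply: le_trans (cabsD _ _) _; rewrite lerD2r.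
Qed.

End Modulus.

(** * Inner-product calculus, subspaces, and projections along finitely many vectors *)

Section InnerProduct.
Variables (R : realType) (V : lmodType R[i]) (ip : V -> V -> R[i]).
Hypothesis hilb : is_complex_hilbert ip.
Implicit Types (x y z : V) (a b : R[i]).
Local Notation norm := (vnorm ip).

Lemma ipJ x y : ip x y = conjc (ip y x).
Proof. by case: hilb => _ []. Qed.

Lemma ip_lin a x y z : ip (a *: x + y) z = a * ip x z + ip y z.
Proof. by case: hilb => ->. Qed.

Lemma ipDl x y z : ip (x + y) z = ip x z + ip y z.
Proof. by rewrite -[x in LHS]scale1r ip_lin mul1r. Qed.

Lemma ip0l z : ip 0 z = 0.
Proof. by apply: (addrI (ip 0 z)); rewrite -ipDl !addr0. Qed.

Lemma ipZl a x z : ip (a *: x) z = a * ip x z.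
Proof. by rewrite -[a *: x]addr0 ip_lin ip0l addr0. Qed.

Lemma ipNl x z : ip (- x) z = - ip x z.
Proof. by rewrite -scaleN1r ipZl mulN1r. Qed.

Lemma ipBl x y z : ip (x - y) z = ip x z - ip y z.
Proof. by rewrite ipDl ipNl. Qed.

Lemma ip_suml (I : Type) (s : seq I) (F : I -> V) z :
  ip (\sum_(i <- s) F i) z = \sum_(i <- s) ip (F i) z.
Proof. exact: (big_morph (ip^~ z) (fun x y => ipDl x y z) (ip0l z)). Qed.

Lemma ipDr x y z : ip x (y + z) = ip x y + ip x z.
Proof. by rewrite ipJ ipDl conjcD -!ipJ. Qed.

Lemma ip0r x : ip x 0 = 0.
Proof. by rewrite ipJ ip0l conjc0. Qed.

Lemma ipZr a x y : ip x (a *: y) = conjc a * ip x y.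
Proof. by rewrite ipJ ipZl conjcM -ipJ. Qed.

Lemma ipNr x y : ip x (- y) = - ip x y.
Proof. by rewrite ipJ ipNl conjcN -ipJ. Qed.

Lemma ipBr x y z : ip x (y - z) = ip x y - ip x z.
Proof. by rewrite ipDr ipNr. Qed.

Lemma ip_sumr (I : Type) (s : seq I) (F : I -> V) x :
  ip x (\sum_(i <- s) F i) = \sum_(i <- s) ip x (F i).
Proof. exact: (big_morph (ip x) (ipDr x) (ip0r x)). Qed.

Lemma vnorm_ge0 x : 0 <= norm x. Proof. exact: sqrtr_ge0. Qed.

Lemma vnorm_sqr x : norm x ^+ 2 = complex.Re (ip x x).
Proof. by rewrite sqr_sqrtr //; case: hilb => _ [_ []]. Qed.

Lemma ipxx x : ip x x = (norm x ^+ 2)%:C.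
Proof.
rewrite vnorm_sqr; have := ipJ x x; case: (ip x x) => a b [] /= bN.
by congr Complex; lra.
Qed.

Lemma ipxx_unit x : norm x = 1 -> ip x x = 1.
Proof. by move=> x1; rewrite ipxx x1 expr1n. Qed.

Lemma vnorm_unit x : ip x x = 1 -> norm x = 1.
Proof. by move=> x1; rewrite /vnorm x1 sqrtr1. Qed.

Lemma vnorm0 : norm 0 = 0.
Proof. by rewrite /vnorm ip0l sqrtr0. Qed.

Lemma vnorm_eq0 x : (norm x == 0) = (x == 0).
Proof.
apply/eqP/eqP => [x0|->]; last exact: vnorm0.
case: hilb => _ [_ [_ [ipdef _]]]; apply: ipdef.
by rewrite ipxx x0 expr0n.
Qed.

Lemma vnorm_gt0 x : (0 < norm x) = (x != 0).
Proof. by rewrite lt_def vnorm_eq0 vnorm_ge0 andbT. Qed.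

Lemma vnormZ a x : norm (a *: x) = cabs a * norm x.
Proof.
apply/eqP; rewrite -(eqrXn2 (n := 2)) ?mulr_ge0 ?cabs_ge0 ?vnorm_ge0 //.
rewrite exprMn vnorm_sqr ipZl ipZr mulrA mulcJ Re_realM -vnorm_sqr.
by [].
Qed.

Lemma vnormN x : norm (- x) = norm x.
Proof. by rewrite -scaleN1r vnormZ cabsN cabs1 mul1r. Qed.

Lemma vnorm_sqrB x y :
  norm (x - y) ^+ 2 = norm x ^+ 2 - 2 * complex.Re (ip x y) + norm y ^+ 2.
Proof.
rewrite !vnorm_sqr ipBl !ipBr !ReB (ipJ y x) ReJ; ring.
Qed.

Lemma cauchy_schwarz x y : cabs (ip x y) <= norm x * norm y.
Proof.
have [->|y0] := eqVneq y 0; first by rewrite ip0r cabs0 vnorm0 mulr0.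
rewrite -vnorm_gt0 in y0.
(* This square equals |y|^2 (|x|^2 |y|^2 - |<x, y>|^2). *)
have := sqr_ge0 (norm ((norm y ^+ 2)%:C *: x - ip x y *: y)).
rewrite vnorm_sqrB !vnormZ cabs_real ipZl ipZr Re_realM mulrC mulrAC -mulrA.
rewrite [conjc (ip x y) * _]mulrC mulcJ [complex.Re _%:C]/=.
rewrite (ger0_norm (sqr_ge0 _)) => h.
rewrite -(ler_pXn2r (n := 2)) ?nnegrE ?cabs_ge0 ?mulr_ge0 ?vnorm_ge0 //.
rewrite -(ler_pM2l (x := norm y ^+ 2)) ?exprn_gt0 //.
move: h; rewrite -subr_ge0 => h; rewrite -subr_ge0; apply: le_trans h _.
by rewrite le_eqVlt; apply/orP; left; apply/eqP; ring.
Qed.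

Lemma vnormB x y : norm (x - y) <= norm x + norm y.
Proof.
rewrite -(ler_pXn2r (n := 2)) ?nnegrE ?addr_ge0 ?vnorm_ge0 // vnorm_sqrB.
have := cauchy_schwarz x y; have := Re_le_cabs (ip x y); rewrite ler_norml.
move: (cabs _) (complex.Re _) (norm x) (norm y) => c r a b; nra.
Qed.

Lemma vnormD x y : norm (x + y) <= norm x + norm y.
Proof. by rewrite -[y in x + y]opprK -(vnormN y) vnormB. Qed.

Lemma vnorm_dist x y : `|norm x - norm y| <= norm (x - y).
Proof.
have := vnormD (x - y) y; have := vnormB x (x - y).
by rewrite subrK subKr ler_norml; lra.
Qed.

Lemma vnormalize x : x != 0 -> norm ((norm x)^-1%:C *: x) = 1.
Proof.
rewrite -vnorm_gt0 => x0; rewrite vnormZ cabs_real gtr0_norm ?invr_gt0 //.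
by rewrite mulVf // gt_eqF.
Qed.

Definition vnull (u : nat -> V) := null (fun n => norm (u n)).

Implicit Types u v : nat -> V.

Lemma vnull_eq u v : u =1 v -> vnull u -> vnull v.
Proof. by move=> uv; apply: null_le => n; rewrite uv. Qed.

Lemma vnullD u v : vnull u -> vnull v -> vnull (fun n => u n + v n).
Proof. by move=> u0 v0; apply: null_le (nullD u0 v0) => n; apply: vnormD. Qed.

Lemma vnullZ (c : nat -> R[i]) x : cnull c -> vnull (fun n => c n *: x).
Proof.
move=> c0; apply: null_le (nullM (vnorm_ge0 x) c0) => n.
by rewrite vnormZ mulrC.
Qed.

Lemma vnull_sum (I : eqType) (s : seq I) (F : I -> nat -> V) :
  (forall i, i \in s -> vnull (F i)) -> vnull (fun n => \sum_(i <- s) F i n).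
Proof.
elim: s => [|i s IHs] F0.
  by apply: null_le (@null0 R) => n; rewrite big_nil vnorm0.
apply: (@vnull_eq (fun n => F i n + \sum_(i <- s) F i n)).
  by move=> n; rewrite big_cons.
apply: vnullD; first by apply: F0; rewrite mem_head.
by apply: IHs => j js; apply: F0; rewrite in_cons js orbT.
Qed.

Lemma cnull_ip u v (M : R) : vnull u -> (forall n, norm (v n) <= M) ->
  cnull (fun n => ip (u n) (v n)).
Proof.
move=> u0 vM; have M0 : 0 <= M by apply: le_trans (vM 0%N); apply: vnorm_ge0.
apply: cnull_le (nullM M0 u0) => n; apply: le_trans (cauchy_schwarz _ _) _.
by rewrite mulrC; apply: ler_wpM2r; rewrite ?vnorm_ge0.
Qed.

Lemma cnull_ipr u v (M : R) : vnull u -> (forall n, norm (v n) <= M) ->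
  cnull (fun n => ip (v n) (u n)).
Proof.
move=> u0 vM; apply: (cnull_eq _ (cnullJ (cnull_ip u0 vM))) => n.
by rewrite -ipJ.
Qed.

Lemma vnull_bounded u : vnull u -> exists M : R, forall n, norm (u n) <= M.
Proof.
move=> u0; have /cnull_bounded[M uM] : cnull (fun n => (norm (u n))%:C).
  by apply: cnull_le u0 => n; rewrite cabs_real ger0_norm ?vnorm_ge0.
by exists M => n; have := uM n; rewrite cabs_real; apply: le_trans; apply: ler_norm.
Qed.

Lemma dense_vec : exists d : nat -> V, forall x (eps : R), 0 < eps ->
  exists n, norm (x - d n) < eps.
Proof.
case: hilb => _ [_ [_ [_ [_ [[d dP] _]]]]]; exists d => x e e0.
by have [_ [[n ->] ?]] := dP x e e0; exists n.
Qed.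

(** Split [y] into [y - d k], whose pairing with [u n] is uniformly small because [u] is bounded,
    and [d k], where the hypothesis applies. *)
Lemma weak_to0_dense (d : nat -> V) u (M : R) :
  (forall x (eps : R), 0 < eps -> exists n, norm (x - d n) < eps) ->
  (forall n, norm (u n) <= M) ->
  (forall k, cnull (fun n => ip (u n) (d k))) -> weak_to0 ip u.
Proof.
move=> dP uM ud y e e0.
have M0 : 0 <= M by apply: le_trans (uM 0%N); apply: vnorm_ge0.
have [|k dk] := dP y (e / 2 / (M + 1)); first by rewrite !divr_gt0 //; lra.
have [|N udN] := ud k (e / 2); first by lra.
exists N => n /udN un; rewrite subr0 -[y](subrK (d k)) ipDr.
apply: le_lt_trans (cabsD _ _) _.
move: dk; rewrite ltr_pdivlMr; last by lra.
have h1 : norm (u n) * norm (y - d k) <= norm (y - d k) * (M + 1).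
  by rewrite mulrC ler_wpM2l ?vnorm_ge0 //; have := uM n; lra.
by have := cauchy_schwarz (u n) (y - d k); lra.
Qed.

Section Subspace.
Variables (E : V -> Prop).
Hypothesis subE : is_subspace E.

Lemma subspace0 : E 0. Proof. by case: subE. Qed.

Lemma subspaceZ a x : E x -> E (a *: x).
Proof.
move=> Ex; rewrite -[a *: x]addr0; case: subE => E0 EP.
exact: EP.
Qed.

Lemma subspaceD x y : E x -> E y -> E (x + y).
Proof. by move=> Ex Ey; rewrite -[x]scale1r; case: subE => _; apply. Qed.

Lemma subspaceB x y : E x -> E y -> E (x - y).
Proof.
by move=> Ex Ey; rewrite -[- y]scaleN1r; apply: subspaceD => //; apply: subspaceZ.
Qed.

Lemma subspace_sum (I : eqType) (s : seq I) (F : I -> V) :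
  (forall i, i \in s -> E (F i)) -> E (\sum_(i <- s) F i).
Proof.
move=> EF; rewrite big_seq; elim/big_ind: _ => //; first exact: subspace0.
exact: subspaceD.
Qed.

End Subspace.

Lemma subspaceI (E F : V -> Prop) : is_subspace E -> is_subspace F ->
  is_subspace (fun x => E x /\ F x).
Proof.
move=> [E0 EP] [F0 FP]; split=> [//|a x y [Ex Fx] [Ey Fy]].
by split; [apply: EP | apply: FP].
Qed.

Definition orth_seq (s : seq V) x := forall f, f \in s -> ip x f = 0.

Lemma orth_seq_subspace s : @is_subspace R V (orth_seq s).
Proof.
split=> [f _|a x y xs ys f fs]; first exact: ip0l.
by rewrite ip_lin xs // ys // mulr0 addr0.
Qed.

Lemma in_span_subspace s : @is_subspace R V (in_span s).
Proof.
split; first by exists (fun=> 0); rewrite big1 // => i _; rewrite scale0r.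
move=> a x y [c ->] [d ->]; exists (fun i => a * c i + d i).
rewrite scaler_sumr -big_split; apply: eq_bigr => i _ /=.
by rewrite scalerDl scalerA.
Qed.

Lemma mem_span s x : x \in s -> in_span s x.
Proof.
move=> xs; have ix : (index x s < size s)%N by rewrite index_mem.
exists (fun i => (i == Ordinal ix)%:R); rewrite (bigD1 (Ordinal ix)) //= eqxx scale1r.
rewrite nth_index // big1 ?addr0 // => i /negbTE ->.
by rewrite scale0r.
Qed.

Lemma orth_span s x : orth_compl ip (in_span s) x <-> orth_seq s x.
Proof.
split=> [xs f /mem_span /xs //|xs y [c ->]].
rewrite ip_sumr big1 // => i _; rewrite ipZr xs ?mulr0 //.
exact: mem_nth.
Qed.

Lemma span_finite_dim s : @finite_dim_subspace R V (in_span s).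
Proof. by split; [exact: in_span_subspace | exists s]. Qed.

(* [gh] is a list of pairs [(g, h)], each standing for the rank-one map [x |-> <x, h> g]. *)
Definition dyad_map (gh : seq (V * V)) x := \sum_(p <- gh) ip x p.2 *: p.1.

Lemma dyad_map_lin gh a x y :
  dyad_map gh (a *: x + y) = a *: dyad_map gh x + dyad_map gh y.
Proof.
rewrite /dyad_map scaler_sumr -big_split; apply: eq_bigr => p _ /=.
by rewrite ip_lin scalerDl scalerA.
Qed.

Lemma dyad_mapB gh x y : dyad_map gh (x - y) = dyad_map gh x - dyad_map gh y.
Proof.
by rewrite -[x - y]addrC -scaleN1r dyad_map_lin scaleN1r addrC.
Qed.

Lemma dyad_map_in (E : V -> Prop) gh x : is_subspace E ->
  (forall p, p \in gh -> E p.1) -> E (dyad_map gh x).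
Proof.
move=> Esub Egh; apply: subspace_sum => // p /Egh.
exact: subspaceZ.
Qed.

Lemma dyad_map_bound gh : exists2 M : R, 0 <= M & forall x, norm (dyad_map gh x) <= M * norm x.
Proof.
exists (\sum_(p <- gh) norm p.2 * norm p.1).
  by apply: sumr_ge0 => p _; rewrite mulr_ge0 ?vnorm_ge0.
move=> x; rewrite /dyad_map mulr_suml.
elim: gh => [|p gh IH]; first by rewrite !big_nil vnorm0.
rewrite !big_cons; apply: le_trans (vnormD _ _) (lerD _ IH).
rewrite vnormZ mulrAC ler_wpM2r ?vnorm_ge0 // mulrC.
exact: cauchy_schwarz.
Qed.

Lemma dyad_map_null gh u : (forall p, p \in gh -> cnull (fun n => ip (u n) p.2)) ->
  vnull (fun n => dyad_map gh (u n)).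
Proof. by move=> uh; apply: vnull_sum => p /uh; apply: vnullZ. Qed.

(* [x - dyad_map gh x] is the projection of [x] to the orthogonal complement of [s]
   along the span of the first components of [gh]. *)
Definition corrects (gh : seq (V * V)) (s : seq V) x := orth_seq s (x - dyad_map gh x).

(** The vector [h] is chosen so that <x, h> is the component along [f] that remains after correction
    by [gh]. Removing it along [g] does not spoil orthogonality to [s]. *)
Lemma corrects_step gh s g f : orth_seq s g -> ip g f = 1 ->
  exists h, forall x, corrects gh s x -> corrects ((g, h) :: gh) (f :: s) x.
Proof.
move=> gs gf; exists (f - \sum_(p <- gh) conjc (ip p.1 f) *: p.2) => x xs k.
have -> : x - dyad_map ((g, f - \sum_(p <- gh) conjc (ip p.1 f) *: p.2) :: gh) x =
          (x - dyad_map gh x) - ip (x - dyad_map gh x) f *: g.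
  rewrite {1}/dyad_map big_cons /= opprD addrCA addrC; congr (_ - _ *: _).
  rewrite ipBr ipBl; congr (_ - _).
  rewrite ip_sumr ip_suml; apply: eq_bigr => p _.
  by rewrite ipZr ipZl conjcK mulrC.
rewrite in_cons => /orP[/eqP ->|ks]; rewrite ipBl ipZl.
  by rewrite gf mulr1 subrr.
by rewrite gs // xs // mulr0 subr0.
Qed.

(** Induction on [s], in the manner of Gram-Schmidt, with all correcting vectors taken from [E];
    thus the corrected vectors stay in [E]. *)
Lemma corrects_exists (E : V -> Prop) s : is_subspace E ->
  exists gh : seq (V * V), (forall p, p \in gh -> E p.1) /\ (forall x, E x -> corrects gh s x).
Proof.
move=> Esub; elim: s => [|f s [gh [Egh ghP]]]; first by exists [::].
have [[g [[Eg gs] gf]]|no_g] := pselect (exists g, (E g /\ orth_seq s g) /\ ip g f != 0).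
  pose g1 := (ip g f)^-1 *: g.
  have g1s : orth_seq s g1 by move=> k ks; rewrite ipZl (gs k ks) mulr0.
  have g1f : ip g1 f = 1 by rewrite ipZl mulVf.
  have [h hP] := corrects_step gh g1s g1f.
  exists ((g1, h) :: gh); split=> [p|x Ex]; last by apply/hP/ghP.
  rewrite in_cons => /orP[/eqP -> /=|]; last exact: Egh.
  exact: subspaceZ.
(* Here every vector of [E] orthogonal to [s] is orthogonal to [f] as well, so the old list already
   corrects for [f]. *)
exists gh; split=> // x Ex k; rewrite in_cons => /orP[/eqP ->|]; last exact: ghP.
apply/eqP/negPn/negP => xf; apply: no_g; exists (x - dyad_map gh x); split=> //.
by split; [apply: subspaceB => //; apply: dyad_map_in | apply: ghP].
Qed.

(** The corrected vector lies in [E] and is orthogonal to [s], hence is 0. So [E] is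
    finite-dimensional, with coordinate functionals <., h>. *)
Lemma finite_dim_dyad_map (E : V -> Prop) s : is_subspace E ->
  (forall x, E x -> orth_seq s x -> x = 0) ->
  exists gh : seq (V * V), (forall p, p \in gh -> E p.1) /\ (forall x, E x -> x = dyad_map gh x).
Proof.
move=> Esub E0; have [gh [Egh ghP]] := corrects_exists s Esub.
exists gh; split=> // x Ex; apply/eqP; rewrite -subr_eq0; apply/eqP.
apply: E0; last exact: ghP.
by apply: subspaceB => //; apply: dyad_map_in.
Qed.

(** Coordinates on the span that do not ask [s] to be linearly independent. *)
Lemma span_dyad_map s : exists gh : seq (V * V), (forall p, p \in gh -> in_span s p.1) /\
  (forall x, in_span s x -> x = dyad_map gh x).
Proof.
apply: (@finite_dim_dyad_map _ s); first exact: in_span_subspace.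
move=> x sx /orth_span/(_ _ sx) xx0; apply/eqP; rewrite -vnorm_eq0.
by rewrite /vnorm xx0 sqrtr0.
Qed.

End InnerProduct.

(** * Separation of a convex set from the origin, in real dimension three and in the complex
    plane *)

Section Separation.
Variable R : realType.

(* The functional is given by the vector of minimal norm in the closure. *)
Lemma strict_separation3 (S : R -> R -> R -> Prop) (m0 : R) :
  (forall x y z x' y' z' t, S x y z -> S x' y' z' -> 0 <= t <= 1 ->
     S (t * x + (1 - t) * x') (t * y + (1 - t) * y') (t * z + (1 - t) * z')) ->
  0 < m0 -> (forall x y z, S x y z -> m0 <= x ^+ 2 + y ^+ 2 + z ^+ 2) ->
  exists a b c eta : R, 0 < eta /\
    forall x y z, S x y z -> eta <= a * x + b * y + c * z.
Proof.
move=> Sconv m0_gt0 Sm0.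
have [[x0 [y0 [z0 S0]]]|Sempty] := pselect (exists x y z, S x y z); last first.
  exists 0, 0, 0, 1; split=> [//|x y z Sxyz].
  by case: Sempty; exists x, y, z.
pose N : set R := fun r => exists x y z, S x y z /\ r = x ^+ 2 + y ^+ 2 + z ^+ 2.
have Nlb : lbound N m0 by move=> _ [x [y [z [/Sm0 ? ->]]]].
have Ninf : has_inf N.
  by split; [exists (x0 ^+ 2 + y0 ^+ 2 + z0 ^+ 2), x0, y0, z0 | exists m0].
pose m := inf N.
have m0m : m0 <= m by apply: lb_le_inf => //; case: Ninf.
have Sm x y z : S x y z -> m <= x ^+ 2 + y ^+ 2 + z ^+ 2.
  by move=> Sxyz; apply: ge_inf; [case: Ninf | exists x, y, z].
have minseq n : exists p : R * R * R, S p.1.1 p.1.2 p.2 /\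
    p.1.1 ^+ 2 + p.1.2 ^+ 2 + p.2 ^+ 2 < m + n.+1%:R^-1.
  have en : 0 < n.+1%:R^-1 :> R by rewrite invr_gt0.
  have [_ [x [y [z [Sxyz ->]]]] lt] := inf_adherent en Ninf.
  by exists (x, y, z).
have [p pP] := choice minseq.
have inv1 n : n.+1%:R^-1 <= 1 :> R by rewrite invf_le1 ?ler1n.
pose u i n := match i with 0%N => (p n).1.1 | 1%N => (p n).1.2 | _ => (p n).2 end.
have [|phi [phiS [l ul]]] := @bolzano_weierstrass_family R u (m + 2) 3.
  move=> i n _; have [_ pn] := pP n; have := inv1 n.
  have := sqr_ge0 (p n).1.1; have := sqr_ge0 (p n).1.2; have := sqr_ge0 (p n).2.
  have bound (r : R) : r ^+ 2 <= m + 1 -> `|r| <= m + 2.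
    by have := sqr_ge0 (r - 1); have := sqr_ge0 (r + 1); rewrite ler_norml; nra.
  by move: (_.+1%:R^-1) pn => d pn ? ? ? ?; rewrite /u; case: i => [|[|i]]; apply: bound; lra.
exists (l 0), (l 1%N), (l 2%N), m; split=> [|x y z Sxyz]; first exact: lt_le_trans m0m.
(* If the functional were below [m] at (x, y, z), a short move from an almost minimal point of [S]
   towards (x, y, z) would give a point of [S] with squared norm below [m]. *)
rewrite leNgt; apply/negP => lt.
set e := (m - (l 0%N * x + l 1%N * y + l 2%N * z)) / 2.
have e0 : 0 < e by rewrite /e; lra.
have eE : 2 * e = m - (l 0%N * x + l 1%N * y + l 2%N * z) by rewrite /e; lra.
clearbody e.
have Q0 : 0 <= x ^+ 2 + y ^+ 2 + z ^+ 2 by rewrite !addr_ge0 ?sqr_ge0.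
(* With step length [tau = e / Q], the second-order terms tau^2 (x^2 + y^2 + z^2 + 2 e) use up less
   than half of the first-order gain 2 tau e; the excess of the almost minimal point, taken below
   tau e, uses less than the other half. *)
pose Q := (x ^+ 2 + y ^+ 2 + z ^+ 2) + 2 * e + 1.
have Qgt0 : 0 < Q by rewrite /Q; lra.
pose tau := e / Q.
have tauQ : tau * Q = e by rewrite /tau divfK ?gt_eqF.
have tau0 : 0 < tau by apply: divr_gt0.
have tau1 : tau <= 1 by rewrite /tau ler_pdivrMr // mul1r /Q; lra.
clearbody tau.
have lim : null (fun n => `|x| * `|u 0%N (phi n) - l 0%N| + `|y| * `|u 1%N (phi n) - l 1%N|
    + `|z| * `|u 2%N (phi n) - l 2%N|).
  by apply: nullD; [apply: nullD|]; apply: nullM; rewrite ?normr_ge0 //; apply: ul.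
have [N1 N1P] := lim e e0.
have [N2 N2P] := null_subseq (strict_mono_ge phiS) (@null_inv R) (mulr_gt0 tau0 e0).
have /N1P := leq_maxl N1 N2; have := leq_maxr N1 N2; move: (maxn N1 N2) => n /N2P.
have [Sp pm] := pP (phi n); have d0 : 0 < (phi n).+1%:R^-1 :> R by rewrite invr_gt0.
rewrite /u; move: ((phi n).+1%:R^-1) pm d0 => d pm d0.
move: (p (phi n)) Sp pm => [[a b] c] /= Sp pm dtau near.
have f_lt : a * x + b * y + c * z < m - e.
  have := ler_norm (x * (a - l 0%N)); have := ler_norm (y * (b - l 1%N)).
  have := ler_norm (z * (c - l 2%N)); rewrite !normrM.
  by lra.
have t01 : 0 <= tau <= 1 by rewrite ltW.
have := Sm _ _ _ (Sconv _ _ _ _ _ _ _ Sxyz Sp t01).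
have -> : (tau * x + (1 - tau) * a) ^+ 2 + (tau * y + (1 - tau) * b) ^+ 2 +
    (tau * z + (1 - tau) * c) ^+ 2 = tau ^+ 2 * (x ^+ 2 + y ^+ 2 + z ^+ 2) +
    2 * tau * (1 - tau) * (a * x + b * y + c * z) +
    (1 - tau) ^+ 2 * (a ^+ 2 + b ^+ 2 + c ^+ 2) by ring.
have h1 : 2 * tau * (1 - tau) * (a * x + b * y + c * z) <=
    2 * tau * (1 - tau) * (m - e).
  by apply: ler_wpM2l; [by rewrite !mulr_ge0 //; lra | by lra].
have h2 : (1 - tau) ^+ 2 * (a ^+ 2 + b ^+ 2 + c ^+ 2) <= (1 - tau) ^+ 2 * (m + d).
  apply: ler_wpM2l; [exact: sqr_ge0 | lra].
have h3 : 0 <= tau * (2 - tau) * d by rewrite !mulr_ge0 //; lra.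
have h4 : tau * (tau * Q) = tau * e by rewrite tauQ.
have h5 : 0 <= tau ^+ 2 * (1 + m) by rewrite mulr_ge0 ?sqr_ge0 //; lra.
move: h4; rewrite /Q; move: (_ ^+ 2 + _ + _) h1 h2 => X h1 h2 h4.
by nra.
Qed.



(* The slope of the separating line is the supremum of the slopes of the points of [S]
   in the lower half-plane. *)
Lemma halfplane_pos (S : R[i] -> Prop) (r : R) :
  (forall z w t, S z -> S w -> 0 <= t <= 1 -> S (t%:C * z + (1 - t)%:C * w)) ->
  ~ S 0 -> 0 < r -> S r%:C ->
  exists a, a != 0 /\ forall z, S z -> 0 <= complex.Re (a * z).
Proof.
move=> Sconv S0 r0 Sr.
have Spos (x : R) : S (x +i* 0) -> 0 < x.
  move=> Sx; rewrite ltNge; apply/negP => x0; apply: S0.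
  have t01 : 0 <= r / (r - x) <= 1.
    by rewrite divr_ge0 ?ler_pdivrMr /=; lra.
  have := Sconv _ _ _ Sx Sr t01; congr S; apply/eqP; rewrite eq_complex /=.
  by apply/andP; split; apply/eqP; field; lra.
(* The segment joining points on opposite sides of the real axis crosses it at a point of [S], which
   is positive by [Spos]. *)
have Sopp x y x' y' : S (x +i* y) -> S (x' +i* y') -> 0 < y -> y' < 0 ->
    0 < x * (- y') + x' * y.
  move=> Sz Sw y0 y0'.
  have t01 : 0 <= - y' / (y - y') <= 1.
    by rewrite divr_ge0 ?ler_pdivrMr /=; lra.
  have : S (((x * (- y') + x' * y) / (y - y')) +i* 0).
    have := Sconv _ _ _ Sz Sw t01; congr S; apply/eqP; rewrite eq_complex /=.
    by apply/andP; split; apply/eqP; field; lra.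
  by move=> /Spos; rewrite pmulr_lgt0 // invr_gt0; lra.
have [[x0 [y0 [S0' y0_lt0]]]|nolower] := pselect (exists x y, S (x +i* y) /\ y < 0);
    last first.
  exists (0 -i* 1); split; first by rewrite eq_complex /= oppr_eq0 oner_eq0 andbF.
  move=> [x y] Sz /=; rewrite mul0r mulN1r sub0r opprK leNgt; apply/negP => y0.
  by apply: nolower; exists x, y.
have [[x1 [y1 [S1 y1_gt0]]]|noupper] := pselect (exists x y, S (x +i* y) /\ 0 < y);
    last first.
  exists (0 +i* 1); split; first by rewrite eq_complex /= oner_eq0 andbF.
  move=> [x y] Sz /=; rewrite mul0r mul1r sub0r oppr_ge0 leNgt; apply/negP => y_gt0.
  by apply: noupper; exists x, y.
pose A : set R := fun k => exists x y, S (x +i* y) /\ y < 0 /\ k = x / y.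
have Aub x y : S (x +i* y) -> 0 < y -> ubound A (x / y).
  move=> Sz y_gt0 _ [x' [y' [Sw [y_lt0 ->]]]].
  rewrite ler_pdivlMr // mulrAC ler_ndivrMr //.
  by have := Sopp _ _ _ _ Sz Sw y_gt0 y_lt0; lra.
pose k := sup A.
exists (1 +i* k); split; first by rewrite eq_complex /= oner_eq0.
move=> [x y] Sz /=; rewrite mul1r subr_ge0.
have [y_lt0|y_gt0|yE] := ltgtP y 0.
- rewrite -ler_ndivrMr //; apply: ub_le_sup; last by exists x, y.
  by exists (x1 / y1); apply: Aub.
- rewrite -ler_pdivlMr //; apply: ge_sup; last exact: Aub.
  by exists (x0 / y0), x0, y0.
- by move: Sz; rewrite yE mulr0 => /Spos/ltW.
Qed.

(** Multiplying [S] by the conjugate of one of its points [w] brings the positive number |w|^2 into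
    the set, which reduces to [halfplane_pos]. *)
Lemma halfplane (S : R[i] -> Prop) :
  (forall z w t, S z -> S w -> 0 <= t <= 1 -> S (t%:C * z + (1 - t)%:C * w)) ->
  ~ S 0 -> exists a, a != 0 /\ forall z, S z -> 0 <= complex.Re (a * z).
Proof.
move=> Sconv S0.
have [[w Sw]|Sempty] := pselect (exists w, S w); last first.
  exists 1; split=> [|z Sz]; first exact: oner_neq0.
  by case: Sempty; exists z.
have w0 : w != 0 by apply/eqP => w0; apply: S0; rewrite -w0.
have [||||a [a0 aP]] := @halfplane_pos (fun z => exists2 v, S v & z = v * conjc w)
  (cabs w ^+ 2).
- move=> _ _ t [z Sz ->] [v Sv ->] t01.
  by exists (t%:C * z + (1 - t)%:C * v); [exact: Sconv | rewrite mulrDl !mulrA].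
- move=> [v Sv /esym/eqP]; rewrite mulf_eq0 => /orP[/eqP v0|]; first by rewrite v0 in Sv.
  by rewrite conjc_eq0 (negbTE w0).
- by rewrite exprn_gt0 // cabs_gt0.
- by exists w => //; rewrite mulcJ.
exists (a * conjc w); split; first by rewrite mulf_neq0 ?conjc_eq0.
by move=> z Sz; rewrite -mulrA (mulrC _ z); apply: aP; exists z.
Qed.

End Separation.

(** * Linear algebra behind the geometry of 2x2 Hermitian matrices *)

Section HermitianMatrices.
Variable R : realType.

(** Four unknowns against three equations. The unknowns will be the real coordinates of a Hermitian
    2x2 matrix. *)
Lemma kernel43 (F : nat -> nat -> R) : exists v : nat -> R,
  [|| v 0%N != 0, v 1%N != 0, v 2%N != 0 | v 3%N != 0] /\
  forall j, (j < 3)%N ->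
    v 0%N * F 0%N j + v 1%N * F 1%N j + v 2%N * F 2%N j + v 3%N * F 3%N j = 0.
Proof.
pose A := \matrix_(i < 4, j < 3) F i j.
have /matrix0Pn [i [k ik]] : kermx A != 0.
  rewrite -mxrank_eq0 mxrank_ker subn_eq0 -ltnNge.
  by apply: leq_ltn_trans (rank_leq_col A) _.
have sum4 (G : 'I_4 -> R) :
    \sum_l G l = G (inord 0) + G (inord 1) + G (inord 2) + G (inord 3).
  rewrite !big_ord_recr big_ord0 /= add0r.
  by do !congr (_ + _); congr G; apply/val_inj; rewrite /= inordK.
exists (fun n => kermx A i (inord n)); split.
  rewrite -!negb_and; apply: contra ik => /and4P[/eqP a0 /eqP a1 /eqP a2 /eqP a3].
  rewrite -[k]inord_val; case: k => [[|[|[|[|k]]]]] //= _; exact/eqP.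
move=> j j3; have /matrixP/(_ i (Ordinal j3)) := mulmx_ker A.
rewrite mxE [RHS]mxE => ker0; rewrite -[RHS]ker0 sum4.
rewrite ![A _ _]mxE !inordK //.
Qed.

(** A positive semidefinite Hermitian 2x2 matrix of determinant 0 is the outer product of a vector
    (a, b) with itself. *)
Lemma rank_one_factor (A B : R) (w : R[i]) : 0 <= A -> 0 <= B ->
  cabs w ^+ 2 = A * B ->
  exists a b, [/\ a * conjc a = A%:C, b * conjc b = B%:C & a * conjc b = w].
Proof.
rewrite le_eqVlt => /orP[/eqP <- B0|A0 B0 wAB].
  rewrite mul0r => /eqP; rewrite sqrf_eq0 cabs_eq0 => /eqP ->.
  exists 0, (Num.sqrt B)%:C; rewrite !mul0r; split=> //.
  by rewrite mulcJ cabs_real real_normK ?num_real // sqr_sqrtr.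
pose s := Num.sqrt A; have s0 : 0 < s by rewrite sqrtr_gt0.
have sA : s ^+ 2 = A by rewrite sqr_sqrtr // ltW.
exists s%:C, (s^-1%:C * conjc w); split.
- by rewrite mulcJ cabs_real real_normK ?num_real // sA.
- rewrite mulcJ cabsM cabs_real cabsJ exprMn real_normK ?num_real // wAB.
  by rewrite exprVn sA mulKf ?gt_eqF.
- rewrite conjcM conjcK conjc_real mulrA -rmorphM divff ?mul1r //.
  by rewrite gt_eqF.
Qed.

End HermitianMatrices.

(** * Operators that are linear on a domain *)

Section LinearOn.
Variables (R : realType) (V : lmodType R[i]) (D : V -> Prop) (T : V -> V).
Hypothesis Tlin : lin_op_on D T.

Lemma lin_on_sub : is_subspace D. Proof. by case: Tlin. Qed.

Lemma lin_onD x y : D x -> D y -> T (x + y) = T x + T y.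
Proof. by case: Tlin => _ TP Dx Dy; rewrite -[x]scale1r TP // !scale1r. Qed.

Lemma lin_on0 : T 0 = 0.
Proof.
have D0 := subspace0 lin_on_sub.
by apply: (addrI (T 0)); rewrite -lin_onD // !addr0.
Qed.

Lemma lin_onZ a x : D x -> T (a *: x) = a *: T x.
Proof.
case: Tlin => Dsub TP Dx; rewrite -[a *: x]addr0 TP ?lin_on0 ?addr0 //.
exact: subspace0.
Qed.

Lemma lin_onB x y : D x -> D y -> T (x - y) = T x - T y.
Proof.
move=> Dx Dy; have DNy := subspaceZ lin_on_sub (-1) Dy.
by rewrite -[- y]scaleN1r (lin_onD Dx DNy) (lin_onZ _ Dy) scaleN1r.
Qed.

Lemma lin_on_sum (I : eqType) (s : seq I) (F : I -> V) :
  (forall i, i \in s -> D (F i)) -> T (\sum_(i <- s) F i) = \sum_(i <- s) T (F i).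
Proof.
elim: s => [|i s IHs] DF; first by rewrite !big_nil lin_on0.
have DFs j : j \in s -> D (F j) by move=> js; apply: DF; rewrite in_cons js orbT.
rewrite !big_cons lin_onD ?IHs //; first by apply: DF; rewrite mem_head.
exact: (subspace_sum lin_on_sub).
Qed.

End LinearOn.

Lemma lin_on_restrict (R : realType) (V : lmodType R[i]) (D E : V -> Prop) (T : V -> V) :
  is_subspace E -> (forall x, E x -> D x) -> lin_op_on D T -> lin_op_on E T.
Proof. by move=> Esub ED [_ TP]; split=> // a x y /ED Dx /ED; apply: TP. Qed.

(** * Convexity of the numerical range with control of a second form *)

Section NumericalRange.
Variables (R : realType) (V : lmodType R[i]) (ip : V -> V -> R[i]).
Hypothesis hilb : is_complex_hilbert ip.
Local Notation norm := (vnorm ip).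
Implicit Types (D : V -> Prop) (T P : V -> V).

(** The quadratic form of [T] on the span of [x1] and [x2], extended real-linearly from rank-one
    matrices, that is from vectors, to all Hermitian matrices [[A, w], [w^*, B]]. *)
Definition herm_form (x1 x2 : V) T (A B : R) (w : R[i]) : R[i] :=
  A%:C * ip (T x1) x1 + B%:C * ip (T x2) x2 +
  w * ip (T x1) x2 + conjc w * ip (T x2) x1.

Lemma herm_form_factor D T x1 x2 a b A B w : lin_op_on D T -> D x1 -> D x2 ->
  a * conjc a = A%:C -> b * conjc b = B%:C -> a * conjc b = w ->
  ip (T (a *: x1 + b *: x2)) (a *: x1 + b *: x2) = herm_form x1 x2 T A B w.
Proof.
move=> Tlin Dx1 Dx2 aA bB <-; have Dsub := lin_on_sub Tlin.
rewrite (lin_onD Tlin) ?(lin_onZ Tlin) //; try exact: subspaceZ.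
rewrite !(ipDl hilb, ipDr hilb, ipZl hilb, ipZr hilb) /herm_form -aA -bB.
by rewrite conjcM conjcK; ring.
Qed.

Lemma herm_form_lin x1 x2 T A B w s A' B' w' :
  herm_form x1 x2 T (A + s * A') (B + s * B') (w + s%:C * w') =
  herm_form x1 x2 T A B w + s%:C * herm_form x1 x2 T A' B' w'.
Proof.
by rewrite /herm_form conjcD conjcM conjc_real !rmorphD !rmorphM /=; ring.
Qed.

Lemma herm_formN x1 x2 T A B w :
  herm_form x1 x2 T (- A) (- B) (- w) = - herm_form x1 x2 T A B w.
Proof. by rewrite /herm_form conjcN !rmorphN /=; ring. Qed.

Lemma herm_form_coord x1 x2 T A B u v :
  herm_form x1 x2 T A B (u +i* v) =
  A%:C * herm_form x1 x2 T 1 0 0 + B%:C * herm_form x1 x2 T 0 1 0 +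
  u%:C * herm_form x1 x2 T 0 0 1 + v%:C * herm_form x1 x2 T 0 0 'i.
Proof.
rewrite /herm_form.
case: (ip _ _) (ip _ _) (ip _ _) (ip _ _) => [a b] [c d] [e f] [g h].
by apply/eqP; rewrite eq_complex /=; apply/andP; split; apply/eqP; ring.
Qed.

(** The three equations are the trace condition and the real and imaginary parts of the condition on
    [T]. The sign of the solution is then free, and is used to make the value of [P] nonpositive. *)
Lemma herm_form_kernel x1 x2 T P : exists h k z,
  [/\ (h != 0) || (k != 0) || (z != 0), complex.Re (herm_form x1 x2 id h k z) = 0,
      herm_form x1 x2 T h k z = 0 & complex.Re (herm_form x1 x2 P h k z) <= 0].
Proof.
pose e L (i : nat) := match i with 0%N => herm_form x1 x2 L 1 0 0
  | 1%N => herm_form x1 x2 L 0 1 0 | 2%N => herm_form x1 x2 L 0 0 1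
  | _ => herm_form x1 x2 L 0 0 'i end.
pose F (i j : nat) := match j with 0%N => complex.Re (e id i)
  | 1%N => complex.Re (e T i) | _ => complex.Im (e T i) end.
have [v [vn vF]] := kernel43 F.
move: (v 0%N) (v 1%N) (v 2%N) (v 3%N) vn vF => v0 v1 v2 v3 vn vF.
have nz : (v0 != 0) || (v1 != 0) || ((v2 +i* v3) != 0).
  rewrite -!negb_and; apply: contraL vn => /andP[/andP[/eqP -> /eqP ->] /eqP[-> ->]].
  by rewrite eqxx.
have I0 : complex.Re (herm_form x1 x2 id v0 v1 (v2 +i* v3)) = 0.
  by rewrite herm_form_coord !ReD !Re_realM; apply: (vF 0%N).
have T0 : herm_form x1 x2 T v0 v1 (v2 +i* v3) = 0.
  have := vF 1%N isT; have := vF 2%N isT; rewrite herm_form_coord /F /e.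
  move: (herm_form _ _ _ 1 0 0) (herm_form _ _ _ 0 1 0) => [a1 b1] [a2 b2].
  move: (herm_form _ _ _ 0 0 1) (herm_form _ _ _ 0 0 'i) => [a3 b3] [a4 b4] /= hI hR.
  apply/eqP; rewrite eq_complex /=; apply/andP; split; apply/eqP.
    by rewrite -[RHS]hR; ring.
  by rewrite -[RHS]hI; ring.
have [P0|P0] := lerP (complex.Re (herm_form x1 x2 P v0 v1 (v2 +i* v3))) 0.
  exists v0, v1, (v2 +i* v3); split=> //.
exists (- v0), (- v1), (- (v2 +i* v3)); rewrite !herm_formN !oppr_eq0.
split; rewrite ?ReN ?I0 ?T0 ?oppr0 ?oppr_le0 //; last exact: ltW.
Qed.

(* Pure states are the rank-one points of the cone of positive 2x2 Hermitian matrices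
   [[A, w], [w^*, B]]. The trace and the values of [T] impose three real linear
   constraints in dimension four, hence leave a direction (h, k, z) along which the
   mixture diag(t, 1 - t) can be moved, without increasing the value of [P], until its
   determinant vanishes. *)
Lemma convex_form D T P x1 x2 t : lin_op_on D T -> lin_op_on D P -> D x1 -> D x2 ->
  norm x1 = 1 -> norm x2 = 1 -> 0 <= t <= 1 ->
  exists y, [/\ D y, norm y = 1,
    ip (T y) y = t%:C * ip (T x1) x1 + (1 - t)%:C * ip (T x2) x2 &
    complex.Re (ip (P y) y) <=
      t * complex.Re (ip (P x1) x1) + (1 - t) * complex.Re (ip (P x2) x2)].
Proof.
move=> Tlin Plin Dx1 Dx2 n1 n2 /andP[t0 t1]; have Dsub := lin_on_sub Tlin.
pose g := ip x1 x2.
have g1 : cabs g <= 1 by have := cauchy_schwarz hilb x1 x2; rewrite n1 n2 mulr1.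
(* In the equality case of Cauchy-Schwarz, [x1] and [x2] differ by a phase, so each form takes the
   same value at both. *)
have [gE|g_lt1] := eqVneq (cabs g) 1.
  have x1E : x1 = g *: x2.
    apply/eqP; rewrite -subr_eq0 -(vnorm_eq0 hilb) -sqrf_eq0 (vnorm_sqrB hilb).
    rewrite n1 (vnormZ hilb) gE n2 (ipZr hilb) [conjc g * _]mulrC mulcJ gE /=.
    by apply/eqP; ring.
  have same L : lin_op_on D L -> ip (L x1) x1 = ip (L x2) x2.
    move: g gE {g1} x1E => c cE x1E Llin; rewrite x1E (lin_onZ Llin) // (ipZl hilb).
    by rewrite (ipZr hilb) mulrA mulcJ cE expr1n mul1r.
  exists x1; rewrite (same T) // (same P) //; split=> //.
    by rewrite -mulrDl -rmorphD /= addrC subrK mul1r.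
  by rewrite -mulrDl addrC subrK mul1r.
have {}g1 : cabs g < 1 by rewrite lt_def eq_sym g_lt1.
have reI A B w : complex.Re (herm_form x1 x2 id A B w) = A + B + 2 * complex.Re (w * g).
  rewrite /herm_form !(ipxx_unit hilb) // !mulr1 (ipJ hilb x2) -/g -conjcM.
  by rewrite !ReD ReJ /=; ring.
have wg w : `|complex.Re (w * g)| <= cabs w.
  apply: le_trans (Re_le_cabs _) _; rewrite cabsM.
  by rewrite ler_piMr ?cabs_ge0 // ltW.
have [h [k [z [nz I0 T0 P0]]]] := herm_form_kernel x1 x2 T P.
(* Minus the determinant of the direction. It is positive: since |g| < 1 the Gram matrix is
   definite, and a nonzero semidefinite direction would violate [I0]. *)
pose c := cabs z ^+ 2 - h * k.
have c0 : 0 < c.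
  rewrite ltNge; apply/negP; rewrite subr_le0 => hk.
  have z0 : cabs z = 0.
    apply/eqP/negPn/negP => zn0.
    have zgt : 0 < cabs z by rewrite lt_def zn0 cabs_ge0.
    move: I0; rewrite reI => I0; have := sqr_ge0 (h - k).
    have : `|complex.Re (z * g)| < cabs z.
      by apply: le_lt_trans (Re_le_cabs _) _; rewrite cabsM gtr_pMr.
    rewrite ltr_norml => /andP[l1 l2].
    have : complex.Re (z * g) ^+ 2 < cabs z ^+ 2 by nra.
    nra.
  move: nz I0; rewrite reI; move/eqP: (z0); rewrite cabs_eq0 => /eqP ->.
  rewrite eqxx mul0r mulr0 addr0 orbF => nz I0.
  have h0 : h = 0 by move: hk; rewrite z0; nra.
  by move: nz I0; rewrite h0 eqxx add0r => /eqP.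
(* The determinant of diag(t, 1 - t) + s (h, k, z) is t (1 - t) + b s - c s^2, with discriminant
   [d ^+ 2]; below, [s] is its nonnegative root. *)
pose b := t * k + (1 - t) * h.
pose d := Num.sqrt (b ^+ 2 + 4 * c * (t * (1 - t))).
have tt0 : 0 <= t * (1 - t) by rewrite mulr_ge0 //; lra.
have ct0 : 0 <= c * (t * (1 - t)) by rewrite mulr_ge0 // ltW.
have d2 : d ^+ 2 = b ^+ 2 + 4 * c * (t * (1 - t)).
  by rewrite sqr_sqrtr //; have := sqr_ge0 b; lra.
have d0 : 0 <= d by apply: sqrtr_ge0.
pose s := (b + d) / (2 * c).
have sc : 2 * c * s = b + d by rewrite /s mulrC divfK // gt_eqF // mulr_gt0.
have s0 : 0 <= s.
  apply: divr_ge0; last by lra.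
  by clearbody d b; nra.
have root : c * s ^+ 2 = b * s + t * (1 - t).
  apply: (mulfI (x := 4 * c)); first by rewrite gt_eqF // mulr_gt0.
  by clearbody s d; nra.
pose A := t + s * h; pose B := 1 - t + s * k; pose w := 0 + s%:C * z.
have wAB : cabs w ^+ 2 = A * B.
  rewrite /w add0r cabsM cabs_real ger0_norm // exprMn /A /B.
  by move: root; rewrite /c /b; nra.
have AB1 : A + B + 2 * complex.Re (w * g) = 1.
  by rewrite -reI herm_form_lin ReD Re_realM I0 mulr0 addr0 reI mul0r /=; ring.
(* With determinant 0 and trace at most 0 the matrix would be negative semidefinite, and its pairing
   with the Gram matrix could not be 1 as in [AB1]. *)
have AB0 : 0 < A + B.
  rewrite ltNge; apply/negP => AB0.
  have := wg w; rewrite ler_norml => /andP[w1 w2]; have := sqr_ge0 (A - B).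
  clearbody A B w; nra.
have [A0 B0] : 0 <= A /\ 0 <= B.
  have := sqr_ge0 (cabs w); rewrite wAB; clearbody A B.
  by move=> ?; split; rewrite leNgt; apply/negP => ?; nra.
have [al [be [alA beB alw]]] := rank_one_factor A0 B0 wAB.
exists (al *: x1 + be *: x2); split.
- by apply: subspaceD => //; apply: subspaceZ.
- apply: (vnorm_unit (ip := ip)).
  have idlin : lin_op_on D id by [].
  have := herm_form_factor idlin Dx1 Dx2 alA beB alw => hI.
  by rewrite (ipxx hilb) (vnorm_sqr hilb) hI reI AB1.
- rewrite (herm_form_factor Tlin Dx1 Dx2 alA beB alw) herm_form_lin T0 mulr0 addr0.
  by rewrite /herm_form conjc0 !mul0r !addr0.
- rewrite (herm_form_factor Plin Dx1 Dx2 alA beB alw) herm_form_lin ReD Re_realM.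
  rewrite /herm_form conjc0 !mul0r !addr0 ReD !Re_realM gerDl.
  exact: mulr_ge0_le0.
Qed.

End NumericalRange.

(** * From orthonormal sequences to weakly null ones, and stability under compact perturbations *)

Lemma summable_null (R : realType) (a : nat -> R) (M : R) : (forall n, 0 <= a n) ->
  (forall n, \sum_(0 <= i < n) a i <= M) -> null a.
Proof.
move=> a0 aM; apply: contrapT => /existsNP[e /not_implyP[e0 /forallNP noN]].
have big N : exists2 n, (N <= n)%N & e <= a n.
  have /existsNP[n /not_implyP[Nn /negP]] := noN N.
  by rewrite -leNgt => an; exists n.
have sums k : exists m, k%:R * e <= \sum_(0 <= i < m) a i.
  elim: k => [|k [m km]]; first by exists 0%N; rewrite mul0r big_nil.
  have [n mn an] := big m; exists n.+1.
  rewrite big_nat_recr //= -natr1 mulrDl mul1r lerD //.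
  by apply: le_trans km _; rewrite (big_cat_nat (leq0n m) mn) /= lerDl sumr_ge0.
have [k Mk] := archi_nat (M / e); have [m km] := sums k.
move: Mk; rewrite ltr_pdivrMr // ltNge => /negP; apply.
exact: le_trans km (aM m).
Qed.

Section Inclusions.
Variables (R : realType) (V : lmodType R[i]) (ip : V -> V -> R[i]).
Hypothesis hilb : is_complex_hilbert ip.
Local Notation norm := (vnorm ip).

(** Bessel's inequality: the squared coefficients of [y] are summable, because subtracting the first
    n of them from |y|^2 leaves the squared norm of the remainder [z n]. *)
Lemma orthonormal_weak_to0 (e : nat -> V) : orthonormal_seq ip e -> weak_to0 ip e.
Proof.
move=> eo y.
pose z n := y - \sum_(0 <= i < n) ip y (e i) *: e i.
have ze n : ip (z n) (e n) = ip y (e n).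
  rewrite (ipBl hilb) (ip_suml hilb) big_nat big1 ?subr0 // => i /andP[_ ilt].
  by rewrite (ipZl hilb) eo ltn_eqF // mulr0.
have zn n : norm (z n) ^+ 2 = norm y ^+ 2 - \sum_(0 <= i < n) cabs (ip y (e i)) ^+ 2.
  elim: n => [|n IH]; first by rewrite /z !big_nil !subr0.
  have -> : z n.+1 = z n - ip y (e n) *: e n.
    by rewrite /z big_nat_recr //= opprD addrA.
  rewrite (vnorm_sqrB hilb) IH (vnormZ hilb) (ipZr hilb) ze big_nat_recr //=.
  rewrite [conjc _ * _]mulrC mulcJ (vnorm_unit (ip := ip) (x := e n)) ?eo ?eqxx //=.
  by ring.
have sq : null (fun n => cabs (ip y (e n)) ^+ 2).
  apply: (@summable_null R _ (norm y ^+ 2)) => n; first exact: sqr_ge0.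
  by rewrite -subr_ge0 -zn sqr_ge0.
move=> eps eps0; have [N NP] := sq (eps ^+ 2) (exprn_gt0 2 eps0).
exists N => n /NP; rewrite subr0 (ipJ hilb) cabsJ.
by rewrite ltr_pXn2r // nnegrE ?cabs_ge0 // ltW.
Qed.

Lemma ccvg_cclosure (S : R[i] -> Prop) u l : (forall n, S (u n)) -> ccvg u l -> cclosure S l.
Proof.
by move=> Su ul e e0; have [N /(_ N (leqnn N))] := ul e e0; exists (u N).
Qed.

(** The finitely many coordinates of [K (u n)] are bounded, so Bolzano-Weierstrass applies to all of
    them at once. *)
Lemma bounded_finite_rank_compact (K : V -> V) :
  bounded_op ip K -> finite_rank K -> compact_op ip K.
Proof.
move=> [_ [B KB]] [s Ks] u [M uM].
have [gh [_ ghP]] := span_dyad_map hilb s.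
pose c i n := ip (K (u n)) (nth (0, 0) gh i).2.
(* Real and imaginary parts are interleaved: indices 2i and 2i + 1 carry those of coordinate i. *)
pose f j n := if odd j then complex.Im (c j./2 n) else complex.Re (c j./2 n).
pose H := \sum_(0 <= i < size gh) norm (nth (0, 0) gh i).2.
have [|phi [phiS [l fl]]] := @bolzano_weierstrass_family R f (`|B| * `|M| * H) (size gh).*2.
  move=> j n js; have j2 : (j./2 < size gh)%N by rewrite ltn_half_double.
  have fc : `|f j n| <= cabs (c j./2 n).
    by rewrite /f; case: odd; [exact: Im_le_cabs | exact: Re_le_cabs].
  apply: le_trans fc (le_trans (cauchy_schwarz hilb _ _) _).
  apply: ler_pM; rewrite ?vnorm_ge0 //.
    apply: le_trans (KB _) (le_trans (ler_norm _) _).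
    rewrite normrM ler_pM // (ger0_norm (vnorm_ge0 _ _)).
    exact: le_trans (uM n) (ler_norm _).
  rewrite /H (big_cat_nat (leq0n j./2) (ltnW j2)) /=.
  rewrite (big_ltn j2) /= addrCA lerDl.
  by rewrite addr_ge0 // sumr_ge0 // => i _; apply: vnorm_ge0.
exists phi; split=> //.
exists (\sum_(0 <= i < size gh) (l i.*2 +i* l i.*2.+1) *: (nth (0, 0) gh i).1).
suff : vnull ip (fun n => \sum_(0 <= i < size gh)
    (c i (phi n) - (l i.*2 +i* l i.*2.+1)) *: (nth (0, 0) gh i).1).
  apply: null_le => n; rewrite {1}(ghP _ (Ks (u (phi n)))) /dyad_map.
  rewrite (big_nth (0, 0)) -sumrB le_eqVlt; apply/orP; left; apply/eqP; congr norm.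
  by apply: eq_bigr => i _; rewrite scalerBl.
apply: (vnull_sum hilb) => i; rewrite mem_index_iota => /andP[_ igh].
apply: (vnullZ hilb).
have re := fl i.*2; rewrite ltn_double in re; have {}re := re igh.
have im := fl i.*2.+1; rewrite ltn_Sdouble in im; have {}im := im igh.
apply: cnull_le (nullD re im) => n; apply: le_trans (cabs_le _) _.
rewrite /f /= odd_double /= doubleK uphalf_double.
by case: (c i (phi n)).
Qed.

Variables (D : V -> Prop) (T : V -> V).
Hypothesis Tlin : lin_op_on D T.

Lemma We4_ess l : We4 ip D T l -> ess_num_range ip D T l.
Proof.
move=> [e [De [eo el]]]; exists e; split=> //; split; last first.
  by split=> //; apply: orthonormal_weak_to0.
by move=> n; apply: vnorm_unit; rewrite eo eqxx.
Qed.

(** Along a subsequence [K (x n)] converges in norm to some [k], and <k, x_n> tends to 0, so [K]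
    does not change the limit of the form. *)
Lemma ess_We3 l : ess_num_range ip D T l -> We3 ip D T l.
Proof.
move=> [x [Dx [x1 [xw xl]]]] K _ Kc.
have [|phi [phiS [k Kk]]] := Kc x; first by exists 1 => n; rewrite x1.
have phin := strict_mono_ge phiS.
apply: (@ccvg_cclosure _ (fun n => ip (T (x (phi n)) + K (x (phi n))) (x (phi n)))).
  by move=> n; exists (x (phi n)).
have := cnullD (cnull_ip hilb (M := 1) Kk (v := fun n => x (phi n)) _)
  (cnullJ (null_subseq phin (xw k))).
have := null_subseq phin xl.
move=> c1 c2; apply: (cnull_eq _ (cnullD c1 (c2 _))) => [n|n]; last by rewrite x1.
rewrite subr0 -(ipJ hilb) (ipBl hilb) (ipDl hilb); ring.
Qed.

Lemma We3_We2 l : We3 ip D T l -> We2 ip D T l.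
Proof. by move=> l3 K Kb Kf; apply: l3 => //; apply: bounded_finite_rank_compact. Qed.

End Inclusions.

(** * Finite-rank perturbations: [We2] lies in the essential numerical range *)

Section FiniteRankPerturbation.
Variables (R : realType) (V : lmodType R[i]) (ip : V -> V -> R[i]).
Hypothesis hilb : is_complex_hilbert ip.
Local Notation norm := (vnorm ip).

Lemma dyad_map_bounded_op gh : bounded_op ip (dyad_map ip gh).
Proof.
split; first exact: dyad_map_lin.
by have [M _ MP] := dyad_map_bound hilb gh; exists M.
Qed.

Lemma dyad_map_finite_rank gh : finite_rank (dyad_map ip gh).
Proof.
exists [seq p.1 | p <- gh] => x; apply: dyad_map_in; first exact: in_span_subspace.
by move=> p pgh; apply: mem_span; apply: map_f.
Qed.

Variables (D : V -> Prop) (T : V -> V).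
Hypothesis Tlin : lin_op_on D T.

Lemma lin_on_scale_sub (a l : R[i]) (E : V -> Prop) : is_subspace E ->
  (forall x, E x -> D x) -> lin_op_on E (fun x => a *: (T x - l *: x)).
Proof.
move=> Esub ED; split=> // b x y /ED Dx /ED Dy.
rewrite (lin_onD Tlin) ?(lin_onZ Tlin) //; last exact: subspaceZ (lin_on_sub Tlin) _ _ Dx.
rewrite [l *: _]scalerDr opprD addrACA scalerDr; congr (_ + _).
rewrite [RHS]scalerA [b * a]mulrC -scalerA; congr (_ *: _).
by rewrite scalerBr !scalerA [b * l]mulrC.
Qed.

Lemma ip_scale_sub a l x y : ip (a *: (T x - l *: x)) y = a * (ip (T x) y - l * ip x y).
Proof. by rewrite (ipZl hilb) (ipBl hilb) (ipZl hilb). Qed.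

Lemma We2_far l K r : We2 ip D T l -> bounded_op ip K -> finite_rank K -> 0 < r ->
  ~ (forall x, D x -> norm x = 1 -> r <= cabs (ip (T x) x - l + ip (K x) x)).
Proof.
move=> l2 Kb Kf r0 far; have [_ [[x [Dx [x1 ->]]] close]] := l2 K Kb Kf r r0.
have := far x Dx x1; rewrite leNgt => /negP; apply; move: close.
by rewrite (ipDl hilb) addrAC.
Qed.

Variable d : nat -> V.
Hypothesis dP : forall x (eps : R), 0 < eps -> exists n, norm (x - d n) < eps.

(** The operator c sum <., d_i> d_i. With [c = 1] it gives the form p of the separation argument,
    with other constants the perturbations [K]. *)
Definition dyad_proj (c : R[i]) n := dyad_map ip [seq (c *: d i, d i) | i <- iota 0 n].

Lemma dyad_projE c n x :
  ip (dyad_proj c n x) x = c * (\sum_(i <- iota 0 n) cabs (ip x (d i)) ^+ 2)%:C.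
Proof.
rewrite /dyad_proj /dyad_map big_map (ip_suml hilb) rmorph_sum mulr_sumr.
apply: eq_bigr => i _ /=; rewrite !(ipZl hilb) (ipJ hilb (d i)) -mulcJ.
by ring.
Qed.

(** Otherwise [delta = 1 / (n + 1)] fails for every n. The resulting unit vectors have form values
    tending to [l], and are weakly null because it suffices to test on the dense sequence [d]. *)
Lemma not_ess_gap l : ~ ess_num_range ip D T l ->
  exists n delta, 0 < delta /\ forall x, D x -> norm x = 1 ->
    \sum_(i <- iota 0 n) cabs (ip x (d i)) ^+ 2 < delta ->
    delta <= cabs (ip (T x) x - l).
Proof.
move=> lness; apply: contrapT => nogap; apply: lness.
have seqx n : exists x, [/\ D x, norm x = 1,
    \sum_(i <- iota 0 n) cabs (ip x (d i)) ^+ 2 < n.+1%:R^-1 &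
    cabs (ip (T x) x - l) < n.+1%:R^-1].
  apply: contrapT => nox; apply: nogap; exists n, n.+1%:R^-1; split=> [|x Dx x1 px].
    by rewrite invr_gt0.
  by rewrite leNgt; apply/negP => qx; apply: nox; exists x.
have [x xP] := choice seqx; exists x; split; first by move=> n; case: (xP n).
split; first by move=> n; case: (xP n).
split; last by apply: null_le (@null_inv R) => n; apply: ltW; case: (xP n).
apply: (weak_to0_dense hilb (M := 1) dP) => [n|k]; first by case: (xP n) => _ ->.
move=> e e0; have [N NP] := @null_inv R (e ^+ 2) (exprn_gt0 2 e0).
exists (maxn N k.+1) => n; rewrite geq_max => /andP[/NP ne kn].
rewrite -(ltr_pXn2r (n := 2)) ?nnegrE ?cabs_ge0 ?ltW //.
case: (xP n) => _ _ px _; apply: le_lt_trans (lt_trans px ne).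
rewrite (bigD1_seq k) ?iota_uniq ?mem_iota //= lerDl.
by rewrite sumr_ge0 // => i _; apply: sqr_ge0.
Qed.

Lemma We2_ess_dense l : We2 ip D T l -> ess_num_range ip D T l.
Proof.
move=> l2; apply: contrapT => /not_ess_gap[n [delta [delta0 gap]]].
have Dsub := lin_on_sub Tlin.
pose p x := \sum_(i <- iota 0 n) cabs (ip x (d i)) ^+ 2.
have p0 x : 0 <= p x by apply: sumr_ge0 => i _; apply: sqr_ge0.
(* The factor 1 gives [T - l] the shape treated by [lin_on_scale_sub]. *)
pose T1 x := 1 *: (T x - l *: x).
have T1lin : lin_op_on D T1 by apply: lin_on_scale_sub.
have T1E x : norm x = 1 -> ip (T1 x) x = ip (T x) x - l.
  by move=> x1; rewrite ip_scale_sub (ipxx_unit hilb) // mul1r mulr1.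
clearbody T1.
have Plin : lin_op_on D (dyad_proj 1 n).
  by split=> // a x y _ _; apply: dyad_map_lin.
have PE x : complex.Re (ip (dyad_proj 1 n x) x) = p x by rewrite dyad_projE mul1r.
(* The third coordinate may exceed [p x], since [convex_form] controls the second form only from
   above. *)
pose S a b c := exists x, [/\ D x, norm x = 1, ip (T1 x) x = a +i* b & p x <= c].
have [|||a [b [c [eta [eta0 sep]]]]] := @strict_separation3 R S (delta ^+ 2).
- move=> a b c a' b' c' t [x [Dx x1 qx px]] [y [Dy y1 qy py]] t01.
  have [z [Dz z1 qz]] := convex_form hilb T1lin Plin Dx Dy x1 y1 t01.
  rewrite !PE => pz; exists z; split=> //.
    by rewrite qz qx qy; apply/eqP; rewrite eq_complex /=; apply/andP; split; apply/eqP; ring.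
  case/andP: t01 => t0 t1; apply: le_trans pz (lerD _ _); apply: ler_wpM2l => //.
  by rewrite subr_ge0.
- by rewrite exprn_gt0.
- move=> a b c [x [Dx x1 qx px]].
  have [pd|pd] := ltrP (p x) delta.
    have := gap x Dx x1 pd; rewrite -(T1E x x1) qx => dq.
    apply: le_trans (_ : cabs (a +i* b) ^+ 2 <= _).
      by rewrite ler_pXn2r // nnegrE ?cabs_ge0 ?ltW.
    by rewrite cabs_sqr /= lerDl sqr_ge0.
  apply: le_trans (_ : c ^+ 2 <= _); last by rewrite lerDr addr_ge0 ?sqr_ge0.
  have dc := le_trans pd px; rewrite ler_pXn2r // nnegrE; first exact: ltW.
  exact: le_trans (ltW delta0) dc.
have sepx x : D x -> norm x = 1 -> forall s, 0 <= s ->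
    eta <= complex.Re ((a -i* b) * (ip (T x) x - l)) + c * (p x + s).
  move=> Dx x1 s s0.
  have := sep (complex.Re (ip (T1 x) x)) (complex.Im (ip (T1 x) x)) (p x + s).
  rewrite -T1E //; case qE : (ip (T1 x) x) => [q1 q2] /= h.
  apply: le_trans (h _) _; first by exists x; rewrite qE lerDl.
  by rewrite mulNr opprK.
have [[x0 [Dx0 x01]]|nox] := pselect (exists x, D x /\ norm x = 1); last first.
  apply: (We2_far l2 (dyad_map_bounded_op [::]) (dyad_map_finite_rank [::]) ltr01).
  by move=> x Dx x1; case: nox; exists x.
(* With [c] negative, the slack s = |X| / (-c) would bring the functional down to X - |X|, which is
   at most 0. *)
have c0 : 0 <= c.
  rewrite leNgt; apply/negP => c_lt0.
  pose X := complex.Re ((a -i* b) * (ip (T x0) x0 - l)) + c * p x0.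
  have := sepx x0 Dx0 x01 (`|X| / (- c)); rewrite [c * (_ + _)]mulrDr addrA -/X.
  have -> : c * (`|X| / - c) = - `|X| by field; lra.
  have := ler_norm X => XX h; have : eta <= X - `|X|.
    by apply: h; rewrite divr_ge0 // oppr_ge0 ltW.
  by lra.
(* In this case [c * p] is at least [eta] on unit vectors, so no nonzero vector of [D] is orthogonal
   to the first n vectors of [d]. Hence [D] is finite-dimensional and the form of [T - l] is bounded
   on its unit sphere. *)
have [ab0|ab0] := eqVneq (a -i* b) 0.
  have pc x : D x -> norm x = 1 -> eta <= c * p x.
    move=> Dx x1; have := sepx x Dx x1 0 (lexx 0).
    by rewrite ab0 mul0r addr0 add0r.
  have cgt0 : 0 < c.
    rewrite lt_def c0 andbT; apply/eqP => cE; have := pc x0 Dx0 x01.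
    by rewrite cE mul0r; lra.
  have [|gh [Dgh ghP]] := finite_dim_dyad_map hilb (s := [seq d i | i <- iota 0 n]) Dsub.
    move=> x Dx xd; apply/eqP/negPn/negP => xn0.
    have := pc _ (subspaceZ Dsub _ Dx) (vnormalize hilb xn0).
    rewrite /p big_seq big1 ?mulr0; first by lra.
    move=> i ilt; rewrite (ipZl hilb) xd ?mulr0 ?cabs0 ?expr0n //.
    exact: map_f.
  pose M := \sum_(q <- gh) norm q.2 * norm (T1 q.1).
  have M0 : 0 <= M by apply: sumr_ge0 => q _; rewrite mulr_ge0 ?vnorm_ge0.
  have qM x : D x -> norm x = 1 -> cabs (ip (T x) x - l) <= M.
    move=> Dx x1; rewrite -T1E // {1}(ghP x Dx) /dyad_map.
    rewrite (lin_on_sum T1lin) => [|q qgh]; last exact: subspaceZ Dsub _ _ (Dgh q qgh).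
    rewrite (ip_suml hilb) /M big_seq [in leRHS]big_seq.
    elim/big_ind2: _ => [|z1 r1 z2 r2 h1 h2|q qgh]; first by rewrite cabs0.
      exact: le_trans (cabsD _ _) (lerD h1 h2).
    rewrite (lin_onZ T1lin) ?(ipZl hilb) ?cabsM; last exact: Dgh.
    apply: ler_pM; rewrite ?cabs_ge0 //.
      by have := cauchy_schwarz hilb x q.2; rewrite x1 mul1r.
    by have := cauchy_schwarz hilb (T1 q.1) x; rewrite x1 mulr1.
  (* Chosen so that [k * p x] exceeds the bound [M] by at least 1, which leaves distance 1 from
     [l]. *)
  pose k := (M + 1) * c / eta.
  apply: (We2_far (K := dyad_proj k%:C n) l2 (dyad_map_bounded_op _)
    (dyad_map_finite_rank _) ltr01) => x Dx x1; rewrite dyad_projE -/(p x).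
  have kp : M + 1 <= k * p x.
    rewrite /k mulrAC ler_pdivlMr // -mulrA ler_wpM2l ?pc //; lra.
  have := cabsB (ip (T x) x - l + k%:C * (p x)%:C) (ip (T x) x - l).
  rewrite addrAC subrr add0r -rmorphM cabs_real.
  have := qM x Dx x1; have := ler_norm (k * p x); lra.
(* Multiplied by [a -i* b], the perturbed value minus [l] becomes the separating functional, whose
   real part is at least [eta]. *)
pose al := cabs (a -i* b); have al0 : 0 < al by rewrite cabs_gt0.
apply: (We2_far (K := dyad_proj (c%:C / (a -i* b)) n) l2 (dyad_map_bounded_op _)
  (dyad_map_finite_rank _) (divr_gt0 eta0 al0)) => x Dx x1; rewrite dyad_projE -/(p x).
rewrite ler_pdivrMr // /al -cabsM mulrC mulrDr.
apply: le_trans (le_trans (ler_norm _) (Re_le_cabs _)).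
rewrite mulrA [(a -i* b) * (_ / _)]mulrC divfK // ReD Re_realM /=.
by have := sepx x Dx x1 0 (lexx 0); rewrite addr0.
Qed.

End FiniteRankPerturbation.

Lemma We2_ess (R : realType) (V : lmodType R[i]) (ip : V -> V -> R[i])
  (D : V -> Prop) (T : V -> V) (l : R[i]) :
  is_complex_hilbert ip -> lin_op_on D T -> We2 ip D T l -> ess_num_range ip D T l.
Proof. by move=> hilb Tlin; have [d dP] := dense_vec hilb; apply: We2_ess_dense dP _. Qed.

(** * Recursive choice of orthonormal sequences, and small corrections of weakly null ones *)

Section Sequences.
Variables (R : realType) (V : lmodType R[i]) (ip : V -> V -> R[i]).
Hypothesis hilb : is_complex_hilbert ip.
Local Notation norm := (vnorm ip).
Variables (D : V -> Prop) (T : V -> V).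
Hypothesis Tlin : lin_op_on D T.

(** [Q] is an invariant of the list of vectors chosen so far, newest first; step n is taken with
    precision 1 / (n + 1). *)
Lemma We4_intro (Q : seq V -> Prop) l : Q [::] ->
  (forall s eps, 0 < eps -> Q s -> exists e,
     [/\ D e, norm e = 1, orth_seq ip s e, cabs (ip (T e) e - l) < eps & Q (e :: s)]) ->
  We4 ip D T l.
Proof.
move=> Q0 Qstep.
have next (p : nat * seq V) : exists e, Q p.2 ->
    [/\ D e, norm e = 1, orth_seq ip p.2 e, cabs (ip (T e) e - l) < p.1.+1%:R^-1
      & Q (e :: p.2)].
  have [Qp|] := pselect (Q p.2); last by exists 0.
  have e0 : 0 < p.1.+1%:R^-1 :> R by rewrite invr_gt0.
  by have [e eP] := Qstep _ _ e0 Qp; exists e.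
have [f fP] := choice next.
pose st := fix st n := match n with 0%N => [::] | n'.+1 => f (n', st n') :: st n' end.
pose e n := f (n, st n).
have Qst n : Q (st n) by elim: n => //= n /(fP (n, st n))[].
have eP n := fP (n, st n) (Qst n).
have est m n : (m < n)%N -> e m \in st n.
  elim: n => //= n IH; rewrite ltnS leq_eqVlt in_cons => /orP[/eqP ->|/IH ->].
    by rewrite eqxx.
  by rewrite orbT.
exists e; split; first by move=> n; case: (eP n).
split; last by apply: null_le (@null_inv R) => n; apply: ltW; case: (eP n).
have eo m n : (m < n)%N -> ip (e n) (e m) = 0.
  by move=> /est; case: (eP n) => _ _ eo _ _; apply: eo.
move=> m n; case: ltngtP => [mn|nm|->].
- by rewrite (ipJ hilb) eo // conjc0.
- exact: eo.
- by apply: (ipxx_unit hilb); case: (eP n).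
Qed.

Lemma We1_We4 l : We1 ip D T l -> We4 ip D T l.
Proof.
move=> l1; apply: (We4_intro (Q := fun=> True)) => // s eps eps0 _.
have [_ [[x [[xs Dx] [x1 ->]]] close]] := l1 _ (span_finite_dim s) eps eps0.
by exists x; split=> //; apply/(orth_span hilb).
Qed.

(** The difference is <Tr, r> - <Tx, r> - <Tr, x>. Since [T] may be unbounded, the smallness of [r]
    alone controls neither [T r] nor the middle term. *)
Lemma form_perturb (x r : nat -> V) (M : R) : (forall n, D (x n)) -> (forall n, D (r n)) ->
  (forall n, norm (x n) <= M) -> vnull ip r -> vnull ip (fun n => T (r n)) ->
  cnull (fun n => ip (T (x n)) (r n)) ->
  cnull (fun n => ip (T (x n - r n)) (x n - r n) - ip (T (x n)) (x n)).
Proof.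
move=> Dx Dr xM r0 Tr0 Txr0; have [B rB] := vnull_bounded r0.
apply: (cnull_eq _ (cnullB (cnullB (cnull_ip hilb Tr0 rB) Txr0) (cnull_ip hilb Tr0 xM))) => n.
rewrite (lin_onB Tlin) // !(ipBl hilb) !(ipBr hilb); ring.
Qed.

Lemma normalized_ccvg (z : nat -> V) l : (forall n, D (z n)) ->
  null (fun n => `|norm (z n) - 1|) -> ccvg (fun n => ip (T (z n)) (z n)) l ->
  forall eps, 0 < eps -> exists N, forall n, (N <= n)%N -> z n != 0 /\
    cabs (ip (T ((norm (z n))^-1%:C *: z n)) ((norm (z n))^-1%:C *: z n) - l) < eps.
Proof.
move=> Dz z1 zl eps eps0; have half : 0 < 2^-1 :> R by rewrite invr_gt0.
(* Once the norm nu is within 1/2 of 1, nu^-2 is at most 4 and nu + 1 at most 5/2; their product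
   gives the 10. *)
have l0 : 0 <= 10 * cabs l by rewrite mulr_ge0 ?cabs_ge0.
have four : 0 <= 4 :> R by [].
have [N1 N1P] := z1 _ half.
have [N2 N2P] := nullD (nullM four zl) (nullM l0 z1) eps0.
exists (maxn N1 N2) => n; rewrite geq_max => /andP[/N1P nz /N2P lt].
have nu0 : 0 < norm (z n) by move: nz; rewrite ltr_norml => /andP[]; lra.
split; first by rewrite -(vnorm_gt0 hilb).
rewrite (lin_onZ Tlin) // (ipZl hilb) (ipZr hilb) conjc_real mulrA -rmorphM /=.
move: (norm (z n)) (ip _ _) nz nu0 lt => nu q nz nu0 lt; set i := nu^-1 * nu^-1.
apply: le_lt_trans lt.
have inu : i * nu ^+ 2 = 1 by rewrite /i; field; rewrite gt_eqF.
have i0 : 0 < i by rewrite mulr_gt0 ?invr_gt0.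
have i4 : i <= 4 by move: nz; rewrite ltr_norml => /andP[? ?]; clearbody i; nra.
have -> : i%:C * q - l = i%:C * (q - l) + (i * (1 - nu ^+ 2))%:C * l.
  by rewrite [i * (1 - _)]mulrBr inu mulr1 rmorphB /=; ring.
apply: le_trans (cabsD _ _) _; rewrite !cabsM !cabs_real (gtr0_norm i0).
apply: lerD; first by rewrite ler_wpM2r ?cabs_ge0.
rewrite [leRHS]mulrAC; apply: ler_wpM2r; first exact: cabs_ge0.
rewrite normrM (gtr0_norm i0).
have -> : 1 - nu ^+ 2 = - ((nu - 1) * (nu + 1)) by ring.
rewrite normrN normrM (_ : `|nu + 1| = nu + 1); last by rewrite gtr0_norm // addr_gt0.
have nu52 : nu + 1 <= 5 / 2 by move: nz; rewrite ltr_norml => /andP[? ?]; lra.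
have := normr_ge0 (nu - 1); move: `|nu - 1| => a a0.
have h2 : i * (a * (nu + 1)) <= 4 * (a * (5 / 2)).
  apply: ler_pM => //; [exact: ltW | by rewrite mulr_ge0 //; lra |].
  by rewrite ler_wpM2l.
lra.
Qed.

(** [T] acts here on finitely many fixed vectors only, and the coefficients tend to 0. *)
Lemma lin_on_dyad_map_null gh (x : nat -> V) : (forall p, p \in gh -> D p.1) ->
  (forall p, p \in gh -> cnull (fun n => ip (x n) p.2)) ->
  vnull ip (fun n => T (dyad_map ip gh (x n))).
Proof.
move=> Dgh gh0; have Dsub := lin_on_sub Tlin.
apply: (vnull_eq (u := fun n => \sum_(p <- gh) ip (x n) p.2 *: T p.1)).
  move=> n; rewrite /dyad_map (lin_on_sum Tlin) => [|p pgh].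
    by rewrite big_seq [RHS]big_seq; apply: eq_bigr => p /Dgh Dp; rewrite (lin_onZ Tlin).
  exact: subspaceZ Dsub _ _ (Dgh p pgh).
by apply: (vnull_sum hilb) => p /gh0 h0; apply: (vnullZ hilb).
Qed.

(** The correction tends to 0 together with its image under [T]; boundedness of <T x_n, g> makes the
    remaining cross term of [form_perturb] null. Normalization then keeps the limit. *)
Lemma corrected_ccvg (x : nat -> V) gh l : (forall n, D (x n)) ->
  null (fun n => `|norm (x n) - 1|) -> ccvg (fun n => ip (T (x n)) (x n)) l ->
  (forall p, p \in gh -> [/\ D p.1, cnull (fun n => ip (x n) p.2) &
     exists M : R, forall n, cabs (ip (T (x n)) p.1) <= M]) ->
  forall eps, 0 < eps -> exists N, forall n, (N <= n)%N ->
    let z := x n - dyad_map ip gh (x n) in z != 0 /\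
    cabs (ip (T ((norm z)^-1%:C *: z)) ((norm z)^-1%:C *: z) - l) < eps.
Proof.
move=> Dx x1 xl ghP.
have Dgh p : p \in gh -> D p.1 by case/ghP.
pose r n := dyad_map ip gh (x n).
have Dsub := lin_on_sub Tlin.
have Dr n : D (r n) by apply: (dyad_map_in _ _ Dsub Dgh).
have r0 : vnull ip r by apply: (dyad_map_null hilb (u := x)) => p /ghP[].
have Tr0 : vnull ip (fun n => T (r n)).
  by apply: lin_on_dyad_map_null => // p /ghP[].
have Txr0 : cnull (fun n => ip (T (x n)) (r n)).
  apply: (cnull_eq (u := fun n => \sum_(p <- gh) conjc (ip (x n) p.2) * ip (T (x n)) p.1)).
    by move=> n; rewrite (ip_sumr hilb); apply: eq_bigr => p _; rewrite (ipZr hilb).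
  by apply: cnull_sum => p /ghP[_ h0 [M MP]]; apply: cnullM (cnullJ h0) MP.
have [M xM] : exists M, forall n, norm (x n) <= M.
  have [N NP] := x1 1 ltr01; apply: (eventually_bounded (N := N) (M := 2)) => n /NP.
  by rewrite ltr_norml => /andP[]; lra.
apply: (normalized_ccvg (z := fun n => x n - r n)).
- by move=> n; apply: (subspaceB Dsub).
- apply: null_le (nullD x1 r0) => n.
  rewrite [leRHS]addrC; apply: le_trans (ler_distD (norm (x n)) _ _) (lerD _ (lexx _)).
  apply: le_trans (vnorm_dist hilb _ _) _.
  by rewrite addrAC subrr add0r (vnormN hilb).
- exact: ccvg_perturb xl (form_perturb Dx Dr xM r0 Tr0 Txr0).
Qed.

End Sequences.

(** * Cauchy-Schwarz estimates for a form with values in a half-plane *)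

Section HalfPlane.
Variables (R : realType) (V : lmodType R[i]) (ip : V -> V -> R[i]).
Hypothesis hilb : is_complex_hilbert ip.
Local Notation norm := (vnorm ip).
Variables (D : V -> Prop) (T : V -> V).
Hypothesis Tlin : lin_op_on D T.

(** Cauchy-Schwarz for the Hermitian part of [P], in additive form with a free parameter [tau]. *)
Lemma nonneg_form_cross (E : V -> Prop) (P : V -> V) : lin_op_on E P ->
  (forall x, E x -> 0 <= complex.Re (ip (P x) x)) ->
  forall x y tau, E x -> E y -> 0 < tau ->
    tau * cabs (ip (P x) y + conjc (ip (P y) x)) <=
    complex.Re (ip (P x) x) + tau ^+ 2 * complex.Re (ip (P y) y).
Proof.
move=> Plin P0 x y tau Ex Ey tau0; have Esub := lin_on_sub Plin.
set b := _ + conjc _.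
(* Evaluate the form at [x + c *: y], where [c] has modulus [tau] and the phase making
   the cross term equal to [- tau * cabs b]. *)
have [b0|b0] := eqVneq b 0.
  by rewrite b0 cabs0 mulr0; exact: addr_ge0 (P0 x Ex) (mulr_ge0 (sqr_ge0 _) (P0 y Ey)).
have bgt0 : 0 < cabs b by rewrite cabs_gt0.
pose r := - (tau / cabs b); pose c := r%:C * b.
have := P0 _ (subspaceD Esub Ex (subspaceZ Esub c Ey)).
rewrite (lin_onD Plin) //; last exact: (subspaceZ Esub).
rewrite (lin_onZ Plin) // !(ipDl hilb) !(ipDr hilb) !(ipZl hilb) !(ipZr hilb) !ReD.
have -> : complex.Re (c * ip (P y) x) = complex.Re (conjc c * conjc (ip (P y) x)).
  by rewrite -conjcM ReJ.
have -> : complex.Re (c * (conjc c * ip (P y) y)) = tau ^+ 2 * complex.Re (ip (P y) y).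
  rewrite mulrA mulcJ Re_realM /c cabsM cabs_real exprMn real_normK ?num_real //.
  by rewrite /r sqrrN -exprMn divfK // gt_eqF.
have cb : complex.Re (conjc c * b) = - (tau * cabs b).
  rewrite /c conjcM conjc_real -mulrA Re_realM [conjc b * b]mulrC mulcJ /=.
  by rewrite /r; field; rewrite gt_eqF.
move: cb; rewrite {2}/b mulrDr ReD; lra.
Qed.

(** The values of the form on unit vectors of [E], shifted by the missed value [l], form a convex
    set without 0. So some [P = a (T - l)] has nonnegative real part on [E], and [nonneg_form_cross]
    applies; <Ty, x> and <x, y> obey the usual inequality. *)
Lemma cross_bound (E : V -> Prop) l : is_subspace E -> (forall x, E x -> D x) ->
  (forall x, E x -> norm x = 1 -> ip (T x) x <> l) ->
  exists k, 0 <= k /\ forall x y tau, E x -> E y -> 0 < tau ->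
    tau * cabs (ip (T x) y) <=
    k * (tau * ((norm (T y) + norm y) * norm x) +
         (cabs (ip (T x) x) + norm x ^+ 2) +
         tau ^+ 2 * (cabs (ip (T y) y) + norm y ^+ 2)).
Proof.
move=> Esub ED lE; have TE := lin_on_restrict Esub ED Tlin.
have [||a [a0 aP]] := @halfplane R
    (fun z => exists x, [/\ E x, norm x = 1 & z = ip (T x) x - l]).
- move=> _ _ t [x [Ex x1 ->]] [y [Ey y1 ->]] t01.
  have [z [Ez z1 qz _]] := convex_form hilb TE TE Ex Ey x1 y1 t01.
  exists z; split=> //; rewrite qz rmorphB /=; ring.
- move=> [x [Ex x1 /esym/eqP]]; rewrite subr_eq0 => /eqP.
  exact: lE.
pose P x := a *: (T x - l *: x).
have Plin : lin_op_on E P by exact: (lin_on_scale_sub Tlin a l Esub ED).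
have PE x y : ip (P x) y = a * (ip (T x) y - l * ip x y) by exact: (ip_scale_sub hilb).
clearbody P.
have P0 x : E x -> 0 <= complex.Re (ip (P x) x).
  move=> Ex; have [->|x0] := eqVneq x 0; first by rewrite (ip0r hilb).
  have x1 := vnormalize hilb x0; have Ex1 := subspaceZ Esub (norm x)^-1%:C Ex.
  have : 0 <= complex.Re (ip (P ((norm x)^-1%:C *: x)) ((norm x)^-1%:C *: x)).
    by rewrite PE (ipxx_unit hilb x1) mulr1; apply: aP; exists ((norm x)^-1%:C *: x).
  rewrite (lin_onZ Plin) // (ipZl hilb) (ipZr hilb) conjc_real !Re_realM.
  by rewrite !pmulr_rge0 // invr_gt0 (vnorm_gt0 hilb).
pose L := cabs l; have L0 : 0 <= L by apply: cabs_ge0.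
(* The shift by [l] contributes to both <Px, y> and <Py, x>, whence 2 L. *)
exists (1 + 2 * L); split=> [|x y tau Ex Ey tau0]; first by lra.
have ca0 : 0 < cabs a by rewrite cabs_gt0.
have reP z : complex.Re (ip (P z) z) <= cabs a * (cabs (ip (T z) z) + L * norm z ^+ 2).
  apply: le_trans (le_trans (ler_norm _) (Re_le_cabs _)) _; rewrite PE cabsM.
  apply: ler_wpM2l; first exact: ltW.
  apply: le_trans (cabsB _ _) _; rewrite (ipxx hilb) cabsM cabs_real.
  by rewrite ger0_norm ?sqr_ge0.
have Pyx : cabs (ip (P y) x) <= cabs a * (norm (T y) * norm x + L * (norm y * norm x)).
  rewrite PE cabsM; apply: ler_wpM2l; first exact: ltW.
  apply: le_trans (cabsB _ _) _; rewrite cabsM lerD ?cauchy_schwarz //.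
  by rewrite ler_wpM2l ?cauchy_schwarz.
have Pxy : cabs a * cabs (ip (T x) y) <= cabs (ip (P x) y) + cabs a * (L * (norm y * norm x)).
  have -> : ip (T x) y = (ip (T x) y - l * ip x y) + l * ip x y by rewrite subrK.
  rewrite -cabsM mulrDr -PE; apply: le_trans (cabsD _ _) _; rewrite lerD2l !cabsM.
  apply: ler_wpM2l; first exact: ltW.
  by rewrite ler_wpM2l // (mulrC (norm y)) cauchy_schwarz.
have Pb : cabs (ip (P x) y) <=
    cabs (ip (P x) y + conjc (ip (P y) x)) + cabs (ip (P y) x).
  by rewrite -(cabsJ (ip (P y) x)); apply: le_trans (cabsB _ _); rewrite addrK.
have := nonneg_form_cross Plin P0 Ex Ey tau0.
have := reP x; have := reP y; move: Pb Pxy Pyx {reP P0 PE aP}.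
have := cabs_ge0 (ip (T x) x); have := cabs_ge0 (ip (T y) y).
have := vnorm_ge0 ip x; have := vnorm_ge0 ip y; have := vnorm_ge0 ip (T y).
move: (cabs (ip (P x) y + _)) (cabs (ip (P x) y)) (cabs (ip (P y) x)) => B Bx By.
move: (complex.Re (ip (P x) x)) (complex.Re (ip (P y) y)) => rx ry.
move: (cabs (ip (T x) x)) (cabs (ip (T y) y)) (cabs (ip (T x) y)) => qx qy qxy.
move: (norm x) (norm y) (norm (T y)) (cabs a) ca0 L L0 => nx ny nTy A A0 L L0.
move=> nTy0 ny0 nx0 qy0 qx0 hB hxy hyx hry hrx hform.
rewrite -(ler_pM2l A0).
have t2 := sqr_ge0 tau.
have s1 : tau ^+ 2 * ry <= tau ^+ 2 * (A * (qy + L * ny ^+ 2)) by rewrite ler_wpM2l.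
have s2 : tau * (A * qxy) <= tau * (B + By + A * (L * (ny * nx))).
  by apply: ler_wpM2l; [exact: ltW | lra].
have s3 : tau * By <= tau * (A * (nTy * nx + L * (ny * nx))) by exact: (ler_wpM2l (ltW tau0) hyx).
have s4 : A * (tau * qxy) <= A * ((qx + L * nx ^+ 2) + tau ^+ 2 * (qy + L * ny ^+ 2) +
    tau * (nTy * nx + 2 * L * (ny * nx))) by lra.
apply: le_trans s4 _; apply: ler_wpM2l; first exact: ltW.
have m1 := mulr_ge0 L0 qx0.
have m2 := mulr_ge0 L0 (sqr_ge0 nx).
have m3 := mulr_ge0 t2 (mulr_ge0 L0 qy0).
have m4 := mulr_ge0 t2 (mulr_ge0 L0 (sqr_ge0 ny)).
have m5 := mulr_ge0 (ltW tau0) (mulr_ge0 L0 (mulr_ge0 nTy0 nx0)).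
have m6 := mulr_ge0 (ltW tau0) (mulr_ge0 ny0 nx0).
have m7 := sqr_ge0 nx.
have m8 := mulr_ge0 t2 (sqr_ge0 ny).
lra.
Qed.

(** Fix [tau] in [cross_bound] so small that the term in [y] costs at most eps / 2 after division by
    [tau]; for this [tau] all other terms tend to 0. *)
Lemma cross_null (E : V -> Prop) l (u : nat -> V) y : is_subspace E ->
  (forall x, E x -> D x) -> (forall x, E x -> norm x = 1 -> ip (T x) x <> l) ->
  (forall n, E (u n)) -> vnull ip u -> cnull (fun n => ip (T (u n)) (u n)) -> E y ->
  cnull (fun n => ip (T (u n)) y).
Proof.
move=> Esub ED lE Eu u0 qu0 Ey eps eps0.
have [k [k0 kP]] := cross_bound Esub ED lE.
pose Y := cabs (ip (T y) y) + norm y ^+ 2.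
have Y0 : 0 <= Y by rewrite addr_ge0 ?cabs_ge0 ?sqr_ge0.
have kY0 : 0 <= k * Y by rewrite mulr_ge0.
pose tau := eps / (2 * (k * Y + 1)).
have tauE : tau * (2 * (k * Y + 1)) = eps by rewrite /tau divfK // gt_eqF //; lra.
have tau0 : 0 < tau by apply: divr_gt0 => //; lra.
have usq : null (fun n => norm (u n) ^+ 2).
  have [B uB] := vnull_bounded u0.
  apply: null_le (cnull_ip hilb u0 uB) => n.
  by rewrite (ipxx hilb) cabs_real ger0_norm ?sqr_ge0.
have c0 : 0 <= tau * (norm (T y) + norm y).
  by rewrite mulr_ge0 ?addr_ge0 ?vnorm_ge0 // ltW.
have te : 0 < tau * eps / 2 by rewrite divr_gt0 // mulr_gt0.
have [N NP] := nullM k0 (nullD (nullM c0 u0) (nullD qu0 usq)) te.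
exists N => n /NP nlt; have := kP (u n) y tau (Eu n) Ey tau0; rewrite -/Y => le.
rewrite -(ltr_pM2l tau0); apply: le_lt_trans le _.
move: nlt; rewrite mulrA; move: (_ * norm (u n) + _) => W nlt.
have h : k * (tau ^+ 2 * Y) <= tau * eps / 2.
  have : 0 <= tau * tau by rewrite mulr_ge0 ?ltW.
  by clearbody tau Y; rewrite -tauE; nra.
rewrite mulrDr; lra.
Qed.

End HalfPlane.

(** * Correcting weakly null sequences into an orthogonal complement *)

Lemma uniform_bound (R : realType) (I : eqType) (s : seq I) (Q : I -> R -> Prop) :
  (forall i r r', r <= r' -> Q i r -> Q i r') -> (forall i, i \in s -> exists r, Q i r) ->
  exists r, 0 <= r /\ forall i, i \in s -> Q i r.
Proof.
move=> Qmono; elim: s => [|i s IHs] Qs; first by exists 0.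
have [|r [r0 rs]] := IHs.
  by move=> j js; apply: Qs; rewrite in_cons js orbT.
have [r' Qi] := Qs i (mem_head i s).
exists (Num.max r r'); split=> [|j]; first by rewrite le_max r0.
rewrite in_cons => /orP[/eqP ->|/rs Qj]; [apply: Qmono Qi | apply: Qmono Qj];
by rewrite le_max lexx ?orbT.
Qed.

Section EssentialRange.
Variables (R : realType) (V : lmodType R[i]) (ip : V -> V -> R[i]).
Hypothesis hilb : is_complex_hilbert ip.
Local Notation norm := (vnorm ip).
Variables (D : V -> Prop) (T : V -> V).
Hypothesis Tlin : lin_op_on D T.
Let Dsub := lin_on_sub Tlin.

Lemma finite_dim_orth (M : V -> Prop) : finite_dim_subspace M ->
  exists s, forall x, orth_compl ip M x <-> orth_seq ip s x.
Proof.
move=> [_ [s Ms]]; exists s => x; rewrite -(orth_span hilb).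
by split=> xM v /Ms; apply: xM.
Qed.

(** A late term of the sequence, corrected and normalized, is a unit vector of [D] orthogonal to [s]
    with form value near [l]. *)
Lemma ess_We1_corrected (x : nat -> V) gh s l : (forall n, D (x n)) ->
  (forall n, norm (x n) = 1) -> weak_to0 ip x -> ccvg (fun n => ip (T (x n)) (x n)) l ->
  (forall p, p \in gh -> D p.1 /\ exists M : R, forall n, cabs (ip (T (x n)) p.1) <= M) ->
  (forall n, corrects ip gh s (x n)) ->
  cclosure (num_range ip T (fun y => orth_seq ip s y /\ D y)) l.
Proof.
move=> Dx x1 xw xl ghP xs eps eps0.
have [|p /ghP[Dp Mp]|N NP] := @corrected_ccvg _ _ _ hilb _ _ Tlin x gh l Dx _ xl _ eps eps0.
- by apply: null_le (@null0 R) => n; rewrite x1 subrr normr0.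
- by split=> //; apply: (cnull_eq _ (xw p.2)) => n; rewrite subr0.
have [z0 qz] := NP N (leqnn N); set z := x N - _ in z0 qz.
have Dz : D z by apply: (subspaceB Dsub) => //; apply: (dyad_map_in _ _ Dsub) => p /ghP[].
exists (ip (T ((norm z)^-1%:C *: z)) ((norm z)^-1%:C *: z)); split=> //.
exists ((norm z)^-1%:C *: z); split; last by split=> //; apply: (vnormalize hilb).
split; last exact: (subspaceZ Dsub).
by apply: (subspaceZ (orth_seq_subspace hilb s)); apply: xs.
Qed.

Lemma adj_dom_subspace : is_subspace (adj_dom ip D T).
Proof.
split; first by exists 0 => x _; rewrite !(ip0r hilb).
move=> a y z [y' yP] [z' zP]; exists (a *: y' + z') => x Dx.
by rewrite !(ipDr hilb) !(ipZr hilb) yP // zP.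
Qed.

(** The map [x - dyad_map ip gh x] is continuous, with norm at most 1 + B. *)
Lemma corrects_dense (E : V -> Prop) gh s x : dense ip E ->
  (forall y, E y -> corrects ip gh s y) -> corrects ip gh s x.
Proof.
move=> Edense Ecor f fs; apply/eqP; rewrite -cabs_eq0; apply/negPn/negP => c0.
have [B B0 dB] := dyad_map_bound hilb gh.
pose c := cabs (ip (x - dyad_map ip gh x) f).
have cgt0 : 0 < c by rewrite lt_def c0 cabs_ge0.
have Bf0 : 0 <= (1 + B) * norm f by rewrite mulr_ge0 ?vnorm_ge0 //; lra.
have [|y [Ey]] := Edense x (c / ((1 + B) * norm f + 1)); first by apply: divr_gt0; lra.
rewrite ltr_pdivlMr; last by lra.
have : c <= (1 + B) * norm (x - y) * norm f.
  have -> : c = cabs (ip (x - y - dyad_map ip gh (x - y)) f).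
    have -> : x - y - dyad_map ip gh (x - y) =
        (x - dyad_map ip gh x) - (y - dyad_map ip gh y).
      by rewrite (dyad_mapB hilb) !opprB addrACA [RHS]addrACA [- y - _]addrC.
    by rewrite (ipBl hilb) (Ecor y Ey f fs) subr0.
  apply: le_trans (cauchy_schwarz hilb _ _) _; rewrite ler_wpM2r ?vnorm_ge0 //.
  by apply: le_trans (vnormB hilb _ _) _; rewrite mulrDl mul1r lerD2l.
by have := vnorm_ge0 ip (x - y); clearbody c; nra.
Qed.

(** The correcting vectors come from the adjoint domain, while the [x n] lie only in [D]; density
    extends the correction to them. *)
Lemma ess_We1_adj l : dense ip (fun x => D x /\ adj_dom ip D T x) ->
  ess_num_range ip D T l -> We1 ip D T l.
Proof.
move=> Adense [x [Dx [x1 [xw xl]]]] M /finite_dim_orth[s sP].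
have [gh [Agh ghP]] := corrects_exists hilb s (subspaceI Dsub adj_dom_subspace).
suff clos : cclosure (num_range ip T (fun y => orth_seq ip s y /\ D y)) l.
  move=> e e0; have [q [[y [[ys Dy] yq]] close]] := clos e e0.
  by exists q; split=> //; exists y; split=> //; split=> //; apply/sP.
apply: (ess_We1_corrected (gh := gh) Dx x1 xw xl).
- move=> p /Agh[Dp [z zP]]; split=> //; exists (norm z) => n.
  by rewrite zP //; have := cauchy_schwarz hilb (x n) z; rewrite x1 mul1r.
- by move=> n; apply: corrects_dense Adense ghP.
Qed.

(** [cross_bound] on all of [D] with [tau = 1] bounds <T x_n, g> for each correcting vector. *)
Lemma ess_We1_half l : (exists z, ~ num_range ip T D z) ->
  ess_num_range ip D T l -> We1 ip D T l.
Proof.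
move=> [z0 z0P] [x [Dx [x1 [xw xl]]]] M /finite_dim_orth[s sP].
have [||k [k0 kP]] := @cross_bound _ _ _ hilb _ _ Tlin D z0 Dsub.
- by [].
- by move=> y Dy y1 qy; apply: z0P; exists y.
have [gh [Dgh ghP]] := corrects_exists hilb s Dsub.
have [B qB] := ccvg_bounded xl.
suff clos : cclosure (num_range ip T (fun y => orth_seq ip s y /\ D y)) l.
  move=> e e0; have [q [[y [[ys Dy] yq]] close]] := clos e e0.
  by exists q; split=> //; exists y; split=> //; split=> //; apply/sP.
apply: (ess_We1_corrected (gh := gh) Dx x1 xw xl); last by move=> n; apply: ghP.
move=> p /Dgh Dp; split=> //; exists (k * ((norm (T p.1) + norm p.1) + (B + 1) +
  (cabs (ip (T p.1) p.1) + norm p.1 ^+ 2))) => n.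
have := kP (x n) p.1 1 (Dx n) Dp ltr01.
rewrite x1 expr1n !mul1r mulr1 => le; apply: le_trans le _.
by rewrite ler_wpM2l // lerD2r lerD2l lerD2r.
Qed.

(** The left side has degree one in [u] and the growing terms on the right degree two, so a failure
    can be rescaled to small vectors. *)
Definition rel_bounded (E : V -> Prop) g := exists C : R, forall u, E u ->
  cabs (ip (T u) g) <= C * (1 + cabs (ip (T u) u) + norm u ^+ 2).

(** An absorption argument. For the corrected vectors [u n], the form value is a bounded quantity
    plus <T u_n, r_n>, which is at most half of the weight [X n] for late n. Hence [X n] is bounded,
    and so are <T u_n, g> and <T x_n, g>. *)
Lemma rel_bounded_corrected (E : V -> Prop) (x : nat -> V) gh l :
  (forall n, D (x n)) -> (forall n, norm (x n) = 1) -> weak_to0 ip x ->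
  ccvg (fun n => ip (T (x n)) (x n)) l -> (forall p, p \in gh -> D p.1) ->
  (forall n, E (x n - dyad_map ip gh (x n))) ->
  (forall p, p \in gh -> rel_bounded E p.1) ->
  forall p, p \in gh -> exists M : R, forall n, cabs (ip (T (x n)) p.1) <= M.
Proof.
move=> Dx x1 xw xl Dgh Eu ghE.
have xh p : p \in gh -> cnull (fun n => ip (x n) p.2).
  by move=> _; apply: (cnull_eq _ (xw p.2)) => n; rewrite subr0.
pose r n := dyad_map ip gh (x n); pose u n := x n - r n.
have r0 : vnull ip r by apply: (dyad_map_null hilb (u := x)) => p; exact: xh.
have Tr0 : vnull ip (fun n => T (r n)) by exact: (lin_on_dyad_map_null hilb Tlin Dgh xh).
have Dr n : D (r n) by apply: (dyad_map_in _ _ Dsub Dgh).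
have Du n : D (u n) by exact: (subspaceB Dsub (Dx n) (Dr n)).
have Tx n : T (x n) = T (u n) + T (r n) by rewrite -(lin_onD Tlin) // subrK.
pose X n := 1 + cabs (ip (T (u n)) (u n)) + norm (u n) ^+ 2.
have X0 n : 0 <= X n by rewrite !addr_ge0 ?cabs_ge0 ?sqr_ge0.
have [C [C0 CP]] : exists C : R, 0 <= C /\ forall p, p \in gh ->
    forall n, cabs (ip (T (u n)) p.1) <= C * X n.
  apply: uniform_bound => [p c c' cc' h n|p /ghE[C CP]].
    by apply: le_trans (h n) _; rewrite ler_wpM2r.
  by exists C => n; apply: CP; apply: Eu.
pose w n := \sum_(p <- gh) cabs (ip (x n) p.2).
have w0 : null w.
  suff : cnull (fun n => \sum_(p <- gh) (cabs (ip (x n) p.2))%:C).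
    apply: null_le => n; rewrite -rmorph_sum cabs_real; exact: ler_norm.
  apply: cnull_sum => p /xh; apply: null_le => n.
  by rewrite cabs_real ger0_norm ?cabs_ge0.
have Tur n : cabs (ip (T (u n)) (r n)) <= w n * (C * X n).
  rewrite (ip_sumr hilb) /w mulr_suml big_seq [leRHS]big_seq.
  elim/big_ind2: _ => [|a b a' b' h h'|p /CP pC]; first by rewrite cabs0.
    exact: le_trans (cabsD _ _) (lerD h h').
  by rewrite (ipZr hilb) cabsM cabsJ ler_wpM2l ?cabs_ge0.
have x1le n : norm (x n) <= 1 by rewrite x1.
have [B1 B1P] := cnull_bounded (cnull_ip hilb Tr0 x1le).
have [B2 B2P] := ccvg_bounded xl.
have [B3 B3P] := vnull_bounded r0.
have half : 0 < 2^-1 :> R by rewrite invr_gt0.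
have [N NP] := nullM C0 w0 half.
pose B4 := 2 * (1 + B1 + B2 + (1 + B3) ^+ 2).
have XB n : (N <= n)%N -> X n <= B4.
  move=> /NP wC.
  have un : norm (u n) <= 1 + B3.
    by apply: le_trans (vnormB hilb _ _) _; rewrite x1 lerD2l.
  have un2 : norm (u n) ^+ 2 <= (1 + B3) ^+ 2.
    by have := vnorm_ge0 ip (u n); move: (norm (u n)) un => a; nra.
  have qu : cabs (ip (T (u n)) (u n)) <= B2 + w n * (C * X n) + B1.
    have -> : ip (T (u n)) (u n) = ip (T (x n)) (x n) - ip (T (u n)) (r n) - ip (T (r n)) (x n).
      by rewrite Tx /u (ipDl hilb) (ipBr hilb); ring.
    apply: le_trans (cabsB _ _) (lerD _ (B1P n)).
    exact: le_trans (cabsB _ _) (lerD (B2P n) (Tur n)).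
  have wX : w n * (C * X n) <= 2^-1 * X n.
    by rewrite mulrCA mulrA ler_wpM2r // ltW.
  have XE : X n = 1 + cabs (ip (T (u n)) (u n)) + norm (u n) ^+ 2 by [].
  clear - XE un2 qu wX; clearbody X u w; rewrite /B4.
  move: (X n) (cabs _) (norm _ ^+ 2) XE un2 qu wX => a b c; lra.
move=> p pgh; have [B5 B5P] := vnull_bounded Tr0.
apply: (eventually_bounded (N := N) (M := C * B4 + B5 * norm p.1)) => n nN.
rewrite Tx (ipDl hilb); apply: le_trans (cabsD _ _) (lerD _ _).
  by apply: le_trans (CP p pgh n) _; rewrite ler_wpM2l // XB.
by apply: le_trans (cauchy_schwarz hilb _ _) _; rewrite ler_wpM2r ?vnorm_ge0.
Qed.

(** Take [u] violating the bound with constant k^2, where k = n + 1, and divide it by k s with s^2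
    the weight of [u]. The norm becomes at most 1 / k, the form at most 1 / k^2, and the pairing
    with [g] at least k s. *)
Lemma not_rel_bounded (E : V -> Prop) g : is_subspace E -> (forall x, E x -> D x) ->
  ~ rel_bounded E g -> exists u : nat -> V, [/\ forall n, E (u n), vnull ip u,
    cnull (fun n => ip (T (u n)) (u n)) & forall n, n.+1%:R <= cabs (ip (T (u n)) g)].
Proof.
move=> Esub ED nb.
have next n : exists u, [/\ E u, norm u <= n.+1%:R^-1,
    cabs (ip (T u) u) <= n.+1%:R^-1 & n.+1%:R <= cabs (ip (T u) g)].
  have k1 : 1 <= n.+1%:R :> R by rewrite ler1n.
  move: n.+1%:R k1 => k k1; have k0 : 0 < k by lra.
  have /existsNP[u /not_implyP[Eu /negP]] : ~ forall u, E u ->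
      cabs (ip (T u) g) <= k ^+ 2 * (1 + cabs (ip (T u) u) + norm u ^+ 2).
    by move=> h; apply: nb; exists (k ^+ 2).
  rewrite -ltNge; set X := _ + _ + _ => big.
  have X1 : 1 <= X by rewrite /X -addrA lerDl addr_ge0 ?cabs_ge0 ?sqr_ge0.
  pose s := Num.sqrt X; have s2 : s ^+ 2 = X by rewrite sqr_sqrtr //; lra.
  have s1 : 1 <= s by rewrite -sqrtr1 ler_wsqrtr.
  have t0 : 0 < k * s by rewrite mulr_gt0 //; lra.
  have uX : norm u ^+ 2 <= X by rewrite /X lerDr addr_ge0 ?cabs_ge0.
  have qX : cabs (ip (T u) u) <= X.
    by rewrite /X -addrA addrCA lerDl addr_ge0 ?sqr_ge0.
  have us : norm u <= s.
    by rewrite -(ler_pXn2r (n := 2)) ?nnegrE ?vnorm_ge0 ?s2 //; lra.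
  exists ((k * s)^-1%:C *: u); split.
  - exact: subspaceZ.
  - rewrite (vnormZ hilb) cabs_real gtr0_norm ?invr_gt0 // mulrC ler_pdivrMr //.
    by rewrite mulrA mulVf ?gt_eqF // mul1r.
  - rewrite (lin_onZ Tlin) ?(ipZl hilb) ?(ipZr hilb) ?conjc_real; last exact: ED.
    rewrite !cabsM cabs_real gtr0_norm ?invr_gt0 // mulrA -expr2 exprVn mulrC.
    rewrite ler_pdivrMr ?exprn_gt0 // exprMn s2 mulrA expr2 mulrA mulVf ?gt_eqF // mul1r.
    by apply: le_trans qX _; rewrite ler_peMl //; lra.
  - rewrite (lin_onZ Tlin) ?(ipZl hilb) ?cabsM; last exact: ED.
    rewrite cabs_real gtr0_norm ?invr_gt0 // mulrC ler_pdivlMr //.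
    apply: le_trans (ltW big); rewrite -s2.
    by have : 0 <= k * k * (s * (s - 1)); [rewrite !mulr_ge0 //; lra | nra].
have [u uP] := choice next; exists u; split=> [n||  |n]; try by case: (uP n).
  by apply: null_le (@null_inv R) => n; case: (uP n).
by apply: null_le (@null_inv R) => n; case: (uP n).
Qed.

End EssentialRange.

(** * Orthonormal sequences for points of the essential numerical range *)

Section OrthonormalSequences.
Variables (R : realType) (V : lmodType R[i]) (ip : V -> V -> R[i]).
Hypothesis hilb : is_complex_hilbert ip.
Local Notation norm := (vnorm ip).
Variables (D : V -> Prop) (T : V -> V).
Hypothesis Tlin : lin_op_on D T.
Let Dsub := lin_on_sub Tlin.

(** Otherwise [D] would be finite-dimensional, and a weakly null sequence of unit vectors in it
    would tend to 0 in norm. *)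
Lemma ess_orth_unit l s : ess_num_range ip D T l ->
  exists y, [/\ D y, norm y = 1 & orth_seq ip s y].
Proof.
move=> [x [Dx [x1 [xw _]]]]; apply: contrapT => noy.
have [|gh [Dgh ghP]] := finite_dim_dyad_map hilb (s := s) Dsub.
  move=> y Dy ys; apply/eqP/negPn/negP => y0; apply: noy.
  exists ((norm y)^-1%:C *: y); split; first exact: (subspaceZ Dsub).
    exact: (vnormalize hilb).
  exact: (subspaceZ (orth_seq_subspace hilb s)).
have : vnull ip (fun n => dyad_map ip gh (x n)).
  by apply: (dyad_map_null hilb) => p _; apply: (cnull_eq _ (xw p.2)) => n; rewrite subr0.
move=> /(_ 1 ltr01)[N /(_ N (leqnn N))].
by rewrite -(ghP _ (Dx N)) x1 ltxx.
Qed.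

(* If [u] is null together with its form values while [ip (T (u n)) g] blows up, adding
   [u n + zeta_n *: g] with a small [zeta_n] to a unit vector [y] moves the value of the
   form to any prescribed [l]. The corrections that restore orthogonality are taken in
   [E], where [ip (T (u n)) c] tends to 0. *)
Lemma unbounded_We4 (s0 : seq V) (u : nat -> V) g l l' :
  let E x := D x /\ orth_seq ip s0 x in
  ess_num_range ip D T l' -> D g ->
  (forall x, E x -> norm x = 1 -> ip (T x) x <> l') ->
  (forall n, E (u n)) -> vnull ip u -> cnull (fun n => ip (T (u n)) (u n)) ->
  (forall n, n.+1%:R <= cabs (ip (T (u n)) g)) -> We4 ip D T l.
Proof.
move=> E ess Dg lE Eu u0 qu0 big.
have Esub : is_subspace E by apply: subspaceI (orth_seq_subspace hilb s0).
have ED x : E x -> D x by case.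
have Du n := ED _ (Eu n).
have Tu0 c : E c -> cnull (fun n => ip (T (u n)) c).
  exact: (cross_null hilb Tlin Esub ED lE Eu u0 qu0).
(* The invariant keeps the correcting vectors in [E], where [Tu0] makes the pairings required by
   [corrected_ccvg] bounded. *)
pose Q s := exists gh : seq (V * V), (forall p, p \in gh -> E p.1) /\
  (forall x, corrects ip gh s x).
apply: (We4_intro hilb (Q := Q)); first by exists [::]; split=> // x f.
move=> s eps eps0 [gh [Egh ghs]].
(* Orthogonality to [s0] puts [y] in [E], orthogonality to [s] makes it usable for later
   corrections, and orthogonality to the second components of [gh] leaves it unchanged by the
   present one. *)
have [y [Dy y1 yo]] := ess_orth_unit (s0 ++ s ++ [seq p.2 | p <- gh]) ess.
have ys0 : orth_seq ip s0 y by move=> f fs; apply: yo; rewrite mem_cat fs.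
have ys : orth_seq ip s y by move=> f fs; apply: yo; rewrite !mem_cat fs orbT.
have yh p : p \in gh -> ip y p.2 = 0.
  by move=> pgh; apply: yo; rewrite !mem_cat map_f ?orbT.
have Ey : E y by [].
(* Then <T u_n, zeta_n g> is exactly [l - ip (T y) y]; the conjugate comes from the second argument
   of [ip]. *)
pose t n := ip (T (u n)) g; pose zeta n := conjc ((l - ip (T y) y) / t n).
have t0 n : t n != 0.
  by rewrite -cabs_gt0; apply: lt_le_trans (big n); rewrite ltr0n.
have zeta0 : cnull zeta.
  apply: null_le (nullM (cabs_ge0 (l - ip (T y) y)) (@null_inv R)) => n.
  rewrite cabsJ cabsM cabsV ler_wpM2l ?cabs_ge0 // lef_pV2 ?posrE ?cabs_gt0 ?ltr0n ?t0 //.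
pose v n := u n + zeta n *: g.
have v0 : vnull ip v by apply: (vnullD hilb) => //; apply: (vnullZ hilb).
have Dv n : D (v n) by apply: (subspaceD Dsub) => //; apply: (subspaceZ Dsub).
pose x n := y + v n.
have Dx n : D (x n) by apply: (subspaceD Dsub).
have Tx n : T (x n) = T y + (T (u n) + zeta n *: T g).
  by rewrite /x (lin_onD Tlin) // /v (lin_onD Tlin) ?(lin_onZ Tlin) //; apply: (subspaceZ Dsub).
have x1 : null (fun n => `|norm (x n) - 1|).
  apply: null_le v0 => n; rewrite -y1; apply: le_trans (vnorm_dist hilb _ _) _.
  by rewrite /x addrAC subrr add0r.
have [B vB] := vnull_bounded v0.
have xB n : norm (x n) <= 1 + B.
  by apply: le_trans (vnormD hilb _ _) _; rewrite y1 lerD2l.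
have xl : ccvg (fun n => ip (T (x n)) (x n)) l.
  have c1 : cnull (fun n => ip (T y) (v n)).
    exact: (cnull_ipr hilb (v := fun=> T y) v0 (fun=> lexx _)).
  have c2 : cnull (fun n => zeta n * ip (T g) (x n)).
    apply: (cnullM (M := norm (T g) * (1 + B)) zeta0) => n.
    by apply: le_trans (cauchy_schwarz hilb _ _) _; rewrite ler_wpM2l ?vnorm_ge0.
  apply: (cnull_eq _ (cnullD (cnullD c1 (Tu0 y Ey)) (cnullD qu0 c2))) => n.
  have zt : conjc (zeta n) * t n = l - ip (T y) y by rewrite /zeta conjcK divfK.
  have hu : ip (T (u n)) (x n) =
      ip (T (u n)) y + (ip (T (u n)) (u n) + conjc (zeta n) * t n).
    by rewrite /x /v !(ipDr hilb) (ipZr hilb).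
  have hy : ip (T y) (x n) = ip (T y) y + ip (T y) (v n) by rewrite (ipDr hilb).
  by rewrite Tx !(ipDl hilb) (ipZl hilb) hu zt hy; ring.
have ghP p : p \in gh -> [/\ D p.1, cnull (fun n => ip (x n) p.2) &
    exists M : R, forall n, cabs (ip (T (x n)) p.1) <= M].
  move=> pgh; have Ep := Egh p pgh; split; first exact: ED.
    apply: (cnull_eq _ (cnull_ip hilb (v := fun=> p.2) v0 (fun=> lexx _))) => n.
    by rewrite /x (ipDl hilb) yh // add0r.
  have [M MP] := cnull_bounded (Tu0 _ Ep).
  have [N NP] := cnull_bounded zeta0.
  exists (cabs (ip (T y) p.1) + (M + N * cabs (ip (T g) p.1))) => n.
  rewrite Tx !(ipDl hilb) (ipZl hilb); apply: le_trans (cabsD _ _) _; rewrite lerD2l.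
  apply: le_trans (cabsD _ _) (lerD (MP n) _).
  by rewrite cabsM ler_wpM2r ?cabs_ge0.
have [N1 N1P] := corrected_ccvg hilb Tlin Dx x1 xl ghP eps0.
pose z n := x n - dyad_map ip gh (x n).
have zy : cnull (fun n => ip (z n) y - 1).
  have d0 : vnull ip (fun n => dyad_map ip gh (x n)).
    by apply: (dyad_map_null hilb) => p /ghP[].
  apply: (cnull_eq _ (cnullB (cnull_ip hilb (v := fun=> y) v0 (fun=> lexx _))
    (cnull_ip hilb (v := fun=> y) d0 (fun=> lexx _)))) => n.
  by rewrite /z /x (ipBl hilb) [ip (y + v n) y](ipDl hilb) (ipxx_unit hilb y1); ring.
have [N2 N2P] := zy 1 ltr01.
have [] := N1P (maxn N1 N2) (leq_maxl _ _); have := N2P _ (leq_maxr N1 N2).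
move: (maxn N1 N2) => n; rewrite -/(z n) => zy1 zn0 qz.
have zyn0 : ip (z n) y != 0.
  by apply: contraTneq zy1 => ->; rewrite sub0r cabsN cabs1 ltxx.
set e := (norm (z n))^-1%:C *: z n in qz *.
have ey : ip y e != 0.
  rewrite (ipJ hilb) conjc_eq0 (ipZl hilb) mulf_neq0 // -cabs_gt0 cabs_real.
  by rewrite normr_gt0 invr_eq0 (vnorm_eq0 hilb).
have Dz : D (z n).
  by apply: (subspaceB Dsub) => //; apply: (dyad_map_in _ _ Dsub) => p /Egh/ED.
(* Because of [g], the new vector [e] may lie outside [E]. The next correcting direction is
   therefore a multiple of [y], which is in [E], orthogonal to [s], and not orthogonal to [e]. *)
pose c := (ip y e)^-1 *: y.
have cs : orth_seq ip s c by apply: (subspaceZ (orth_seq_subspace hilb s)).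
have ce : ip c e = 1 by rewrite (ipZl hilb) mulVf.
have [h hP] := corrects_step hilb gh cs ce.
exists e; split=> //.
- exact: (subspaceZ Dsub).
- exact: (vnormalize hilb).
- by apply: (subspaceZ (orth_seq_subspace hilb s)); apply: ghs.
- exists ((c, h) :: gh); split=> [p|w]; last by apply: hP; apply: ghs.
  rewrite in_cons => /orP[/eqP -> /=|]; last exact: Egh.
  exact: (subspaceZ Esub).
Qed.

Lemma ess_We4 l : ess_num_range ip D T l -> We4 ip D T l.
Proof.
move=> ess; have [x [Dx [x1 [xw xl]]]] := ess.
have [|/existsNP[M /not_implyP[/(finite_dim_orth hilb)[s sP] far]]] := pselect (We1 ip D T l).
  exact: We1_We4.
pose E y := D y /\ orth_seq ip s y.
have Esub : is_subspace E by apply: subspaceI (orth_seq_subspace hilb s).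
have ED y : E y -> D y by case.
have farE : ~ cclosure (num_range ip T (fun y => orth_seq ip s y /\ D y)) l.
  move=> clos; apply: far => e e0; have [q [[y [[ys Dy] yq]] close]] := clos e e0.
  by exists q; split=> //; exists y; split=> //; split=> //; apply/sP.
have lE y : E y -> norm y = 1 -> ip (T y) y <> l.
  move=> [Dy ys] y1 qy; apply: farE => e e0; exists l.
  by rewrite subrr cabs0; split=> //; exists y.
have [gh [Dgh ghP]] := corrects_exists hilb s Dsub.
(* If all correcting vectors are relatively bounded, the correction into [E] succeeds and
   contradicts [farE]; otherwise one of them serves as the [g] of [unbounded_We4]. *)
have [rel|] := pselect (forall p, p \in gh -> rel_bounded ip T E p.1).
  case: farE; apply: (ess_We1_corrected hilb Tlin (gh := gh) Dx x1 xw xl).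
    move=> p pgh; split; first exact: Dgh.
    apply: (rel_bounded_corrected hilb Tlin Dx x1 xw xl Dgh _ rel) => // n.
    split; last by apply: ghP.
    by apply: (subspaceB Dsub) => //; apply: (dyad_map_in _ _ Dsub).
  by move=> n; apply: ghP.
move=> /existsNP[p /not_implyP[pgh /(not_rel_bounded hilb Tlin Esub ED)[u [Eu u0 qu0 big]]]].
exact: (unbounded_We4 (u := u) (g := p.1) l ess (Dgh p pgh) lE).
Qed.

End OrthonormalSequences.

Theorem theorem3p1 (R : realType) (V : lmodType R[i]) (ip : V -> V -> R[i])
  (D : V -> Prop) (T : V -> V) :
  is_complex_hilbert ip -> lin_op_on D T ->
  [/\ (* general case *)
      set_subC (We1 ip D T) (We4 ip D T) /\ set_subC (We4 ip D T) (We2 ip D T) /\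
      set_eqC (We2 ip D T) (We3 ip D T) /\ set_eqC (We3 ip D T) (ess_num_range ip D T),
      (* densely defined *)
      dense ip D ->
      set_subC (We1 ip D T) (We4 ip D T) /\ set_eqC (We4 ip D T) (We2 ip D T) /\
      set_eqC (We2 ip D T) (We3 ip D T) /\ set_eqC (We3 ip D T) (ess_num_range ip D T)
    & (dense ip (fun x => D x /\ adj_dom ip D T x) \/
       exists z : R[i], ~ num_range ip T D z) ->
      set_eqC (We1 ip D T) (ess_num_range ip D T) /\
      set_eqC (We2 ip D T) (ess_num_range ip D T) /\
      set_eqC (We3 ip D T) (ess_num_range ip D T) /\
      set_eqC (We4 ip D T) (ess_num_range ip D T)].
Proof.
move=> hilb Tlin.
have e3 := ess_We3 hilb (D := D) (T := T).
have e32 := We3_We2 hilb (D := D) (T := T).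
have e2 l : We2 ip D T l -> ess_num_range ip D T l := We2_ess hilb Tlin.
have e14 := We1_We4 hilb (D := D) (T := T).
have e4 := We4_ess hilb (D := D) (T := T).
have e4' := ess_We4 hilb Tlin.
have E42 : set_eqC (We4 ip D T) (We2 ip D T) by split=> [/e4/e3/e32|/e2/e4'].
have E23 : set_eqC (We2 ip D T) (We3 ip D T) by split=> [/e2/e3|/e32].
have E3 : set_eqC (We3 ip D T) (ess_num_range ip D T) by split=> [/e32/e2|/e3].
have E2 : set_eqC (We2 ip D T) (ess_num_range ip D T) by split=> [/e2|/e3/e32].
have E4 : set_eqC (We4 ip D T) (ess_num_range ip D T) by split=> [/e4|/e4'].
split=> [|//|dense_or_half]; first by split=> //; split=> // l /E42.
split=> // l; split=> [/e14/e4 //|]; case: dense_or_half => h.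
  exact: (ess_We1_adj hilb Tlin h).
exact: (ess_We1_half hilb Tlin h).
Qed.
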